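(* Let $n\ge2$ and let $\mu$ be a finite Radon measure on $\mathbb{R}^n$ for which there is a constant $C$ such that $$\mu(B(x,r))\le C r^{n-1}\quad\text{for all }x\in\operatorname{spt}\mu\text{ and }r>0.$$ Let $K:\mathbb{R}^n\setminus\{0\}\to\mathbb{R}$ be an antisymmetric kernel, i.e. $K(-x)=-K(x)$ for all $x\ne0$, satisfying $$|K(x)|\le C_K|x|^{-(n-1)}\quad\text{for all }x\in\mathbb{R}^n\setminus\{0\},$$ where $C_K$ is a constant depending on $K$. Let $T^{\mu,K}_\varepsilon$, $\varepsilon>0$, be the truncated singular integral operators associated with $\mu$ and $K$. (1) If $\operatorname{spt}\mu$ is $V^i$-directed porous for $i=1,\dots,n$, where $V^i=\{x\in\mathbb{R}^n:x^i=0\}$ are the coordinate hyperplanes, then the operators $T^{\mu,K}_\varepsilon$ converge weakly in $\mathcal{X}_Q(\mathbb{R}^n)$. (2) If $\operatorname{spt}\mu$ is $V$-directed porous for all $V\in G(n,n-1)$, then the operators $T^{\mu,K}_\varepsilon$ converge weakly also in $\mathcal{X}_B(\mathbb{R}^n)$.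
   Context: Notation: $B(x,r)$ is the closed ball with center $x$ and radius $r$; $x=(x^1,\dots,x^n)$; $\operatorname{spt}\mu$ is the support of $\mu$; $G(n,n-1)$ is the set of all $(n-1)$-dimensional linear subspaces of $\mathbb{R}^n$. Directed porosity. Let $V\in G(n,n-1)$. A set $E\subset\mathbb{R}^n$ is $V$-directed porous at $x\in E$ if there is a constant $c(V)_x>0$ such that for all $r>0$ there is $y\in V+x$ with $B(y,c(V)_x r)\subset B(x,r)\setminus E$. The set $E$ is $V$-directed porous if it is $V$-directed porous at every $x\in E$ and $c(V):=\inf\{\sup c(V)_x : x\in E\}>0$, where for each $x$ the supremum is over all admissible constants $c(V)_x$. Truncated operators. The kernel $K$ is assumed $\mu$-measurable, and $(x,y)\mapsto K(x-y)$ (for $x\ne y$) is $\mu\times\mu$-measurable, so that the integrals below make sense. For $\varepsilon>0$, $$T^{\mu,K}_\varepsilon(f)(x)=\int_{|x-y|>\varepsilon}K(x-y)f(y)\,d\mu(y).$$ Function spaces. $Q(\mathbb{R}^n)$ is the family of half-open cubes $A(x,r)=\prod_{i=1}^n[x^i-r/2,x^i+r/2)$, $x\in\mathbb{R}^n$, $r>0$. $\mathcal{X}_Q(\mathbb{R}^n)$ is the space of finite real linear combinations of characteristic functions of cubes in $Q(\mathbb{R}^n)$, and $\mathcal{X}_B(\mathbb{R}^n)$ is the space of finite real linear combinations of characteristic functions of balls $B(x,r)$. Weak convergence. For $\mathcal{X}=\mathcal{X}_Q(\mathbb{R}^n)$ or $\mathcal{X}_B(\mathbb{R}^n)$, the operators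 $T^{\mu,K}_\varepsilon$ converge weakly in $\mathcal{X}$ if for all $f,g\in\mathcal{X}$ the (finite) limit $\lim_{\varepsilon\to0}\int T^{\mu,K}_\varepsilon(f)(x)g(x)\,d\mu(x)$ exists. *)

(* Defs.v *)
From HB Require Import structures.
From mathcomp Require Import all_boot all_order all_algebra.
From mathcomp Require Import all_classical all_reals all_analysis.

Set Implicit Arguments.
Unset Strict Implicit.
Unset Printing Implicit Defensive.

Import Order.TTheory GRing.Theory Num.Theory.
Import numFieldNormedType.Exports.

Local Open Scope classical_set_scope.
Local Open Scope ring_scope.

(** The library's norm on ['rV[R]_n] is the sup norm, so the Euclidean norm and
    its closed balls are defined by hand. The topology of ['rV[R]_n] is the
    usual one (it does not depend on the choice of norm). *)
Definition enorm (R : realType) (n : nat) (x : 'rV[R]_n) : R :=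
  Num.sqrt (\sum_(i < n) x ord0 i ^+ 2).

Definition eball (R : realType) (n : nat) (x : 'rV[R]_n) (r : R) :
  set 'rV[R]_n := [set y | enorm (y - x) <= r].

Definition cube (R : realType) (n : nat) (x : 'rV[R]_n) (r : R) :
  set 'rV[R]_n :=
  [set y | forall i, x ord0 i - r / 2 <= y ord0 i < x ord0 i + r / 2].

(** ['rV[R]_n] with its Borel sigma-algebra. *)
Notation borelRn R n := (g_sigma_algebraType (@open 'rV[R]_n)).

(** Borel form of the definition of a Radon measure. *)
Definition radon (R : realType) (n : nat)
    (mu : {measure set (borelRn R n) -> \bar R}) : Prop :=
  [/\ forall A : set 'rV[R]_n, compact A -> (mu A < +oo)%E,
      forall U : set 'rV[R]_n, open U ->
        mu U = ereal_sup [set mu A | A in [set A : set 'rV[R]_n |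
                                            compact A /\ A `<=` U]] &
      forall A : set (borelRn R n), measurable A ->
        mu A = ereal_inf [set mu U | U in [set U : set 'rV[R]_n |
                                            open U /\ A `<=` U]]].

(** The smallest closed set with [mu]-null complement. *)
Definition spt (R : realType) (n : nat)
    (mu : {measure set (borelRn R n) -> \bar R}) : set 'rV[R]_n :=
  \bigcap_(F in [set F : set 'rV[R]_n | closed F /\ mu (~` F) = 0%E]) F.

(** [admissible E V x c]: [c] can serve as the constant [c(V)_x]. *)
Definition admissible (R : realType) (n : nat) (E V : set 'rV[R]_n)
    (x : 'rV[R]_n) (c : R) : Prop :=
  0 < c /\ forall r : R, 0 < r ->
    exists y : 'rV[R]_n, V (y - x) /\ eball y (c * r) `<=` eball x r `\` E.

Definition directed_porous_at (R : realType) (n : nat) (E V : set 'rV[R]_n)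
    (x : 'rV[R]_n) : Prop :=
  exists c, admissible E V x c.

(** Suprema and infima are taken in [\bar R]: for [E = set0] the constant is
    [+oo], so that the empty set is porous. *)
Definition porosity_constant (R : realType) (n : nat) (E V : set 'rV[R]_n) :
  \bar R :=
  ereal_inf [set ereal_sup [set c%:E | c in admissible E V x] | x in E].

Definition directed_porous (R : realType) (n : nat) (E V : set 'rV[R]_n) :
  Prop :=
  (forall x, E x -> directed_porous_at E V x) /\
  (0 < porosity_constant E V)%E.

Definition coord_hyperplane (R : realType) (n : nat) (i : 'I_n) :
  set 'rV[R]_n := [set x | x ord0 i = 0].

(** "[mu]-measurable" refers to the completion of [mu], whose sigma-algebra
    consists of the Caratheodory measurable sets of the outer measure generated
    by [mu]; likewise for [mu \x mu]. Integrals are taken with respect to the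
    completed measure [(@completed_measure_extension _ _ _ mu)]. *)
Definition mu_measurable_kernel (R : realType) (n : nat)
    (mu : {finite_measure set (borelRn R n) -> \bar R})
    (K : 'rV[R]_n -> R) : Prop :=
  measurable_fun
    ([set x | x != 0] : set (caratheodory_type (mu^*)%mu)) K /\
  measurable_fun
    ([set p : 'rV[R]_n * 'rV[R]_n | p.1 != p.2] :
      set (caratheodory_type ((mu \x mu)%E^*)%mu))
    (fun p : 'rV[R]_n * 'rV[R]_n => K (p.1 - p.2)).

Definition truncated (R : realType) (n : nat)
    (mu : {measure set (borelRn R n) -> \bar R}) (K : 'rV[R]_n -> R)
    (eps : R) (f : 'rV[R]_n -> R) (x : 'rV[R]_n) : \bar R :=
  (\int[(@completed_measure_extension _ _ _ mu)]_(y in [set y | (eps < enorm (x - y))%R])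
     (K (x - y) * f y)%R%:E)%E.

(** Finite real linear combinations of characteristic functions of the sets
    [S x r], [r > 0]. *)
Definition char_span (R : realType) (n : nat)
    (S : 'rV[R]_n -> R -> set 'rV[R]_n) : set ('rV[R]_n -> R) :=
  [set f | exists (m : nat) (a : 'I_m -> R) (x : 'I_m -> 'rV[R]_n)
                  (r : 'I_m -> R),
     (forall j, 0 < r j) /\
     f = (fun z => \sum_(j < m) a j * \1_(S (x j) (r j)) z)].

Definition XQ (R : realType) (n : nat) : set ('rV[R]_n -> R) :=
  char_span (@cube R n).

Definition XB (R : realType) (n : nat) : set ('rV[R]_n -> R) :=
  char_span (@eball R n).

Definition converges_weakly (R : realType) (n : nat)
    (mu : {measure set (borelRn R n) -> \bar R}) (K : 'rV[R]_n -> R)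
    (X : set ('rV[R]_n -> R)) : Prop :=
  forall f g, X f -> X g ->
    exists l : R,
      (fun eps : R => \int[(@completed_measure_extension _ _ _ mu)]_x
         (truncated mu K eps f x * (g x)%:E))%E @ 0^'+ --> l%:E.

(* Main.v *)
Require Import Defs.
From HB Require Import structures.
From mathcomp Require Import all_boot all_order all_algebra.
From mathcomp Require Import all_classical all_reals all_analysis.
From mathcomp Require Import measurable_realfun.
From mathcomp Require Import ring lra.

Set Implicit Arguments.
Unset Strict Implicit.
Unset Printing Implicit Defensive.

Import Order.TTheory GRing.Theory Num.Theory.
Import numFieldNormedType.Exports.

(** Write [n = d + 1] and let [E] be the support of [mu]. By antisymmetry, only
    the part of [K (x - y) * f y * g x] that is antisymmetric in [x] and [y]
    contributes to the integral; as [f y * g x - f x * g y] is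
    [g x * (f y - f x) + f x * (g x - g y)], everything follows by dominated
    convergence once, for every cube or ball [A], the kernel is integrable
    over the pairs that the boundary of [A] separates
    ([weak_convergence_criterion]).

    If [x] and [y] are separated by the boundary of [A] and have distance at
    most [s], then [x] is within [s] of that boundary. By the growth condition
    the pairs at distance about [s] therefore contribute at most a constant
    times [s ^- d * s ^+ d] times the measure of the [s]-neighbourhood of the
    boundary, and it is enough that these measures are summable over the
    scales [s = s0 / N ^ k] ([sheet_integrable]).

    This is where porosity enters. Cut the boundary into [N ^ d] pieces of a
    fraction [1 / N] of the size. A hole of [E] whose centre is near the
    boundary contains the full neighbourhood of one of the pieces, so the
    number of pieces of generation [k] that meet the neighbourhood of [E]
    grows at most like [(N ^ d - 1) ^ k], whereas by the growth condition each
    of them has measure at most a multiple of [N ^- (k * d)]. Hence the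
    measure of the neighbourhood decays geometrically ([patch_tree]).

    The faces of cubes lie in hyperplanes parallel to the coordinate
    hyperplanes, along which the hypothesis of the first part gives holes
    ([hyperplane_thin]). For a sphere one uses the holes along its tangent
    planes, whose distance to the sphere is of second order
    ([sphere_thin]). The porosity constants of all hyperplanes are bounded
    below together by a compactness argument ([uniform_holes]).

    The kernel is measurable only with respect to completed measures. It is
    replaced by a Borel function off a null set of pairs ([borel_kernel],
    [integral_completed]) in order to use Fubini's theorem
    ([integral_truncated]). *)

Local Open Scope classical_set_scope.
Local Open Scope ring_scope.

(** * Completed measures *)

Section completion.
Local Open Scope ereal_scope.
Context d (T : measurableType d) (R : realType).

(** The outer measure is an infimum over countable measurable covers; taking
    covers that are optimal up to [1 / n] and intersecting their unions over
    [n] gives a measurable superset of exactly the same measure. *)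
Lemma measurable_hull (nu : {measure set T -> \bar R}) (X : set T) :
  nu setT < +oo ->
  exists B, [/\ measurable B, X `<=` B & nu B = (nu^*)%mu X].
Proof.
move=> nuT; have fX : (nu^*)%mu X \is a fin_num.
  rewrite ge0_fin_numE ?mu_ext_ge0//.
  apply: (@le_lt_trans _ _ ((nu^*)%mu setT)); first exact: le_mu_ext.
  by rewrite measurable_mu_extE.
have cov n : exists B, [/\ measurable B, X `<=` B &
    nu B <= (nu^*)%mu X + (n.+1%:R^-1)%:E].
  have [_ [A [mA XA] <-] ltA] : exists2 x, [set \sum_(0 <= k <oo) nu (A k) |
      A in measurable_cover X] x & x < (nu^*)%mu X + (n.+1%:R^-1)%:E.
    by apply: lb_ereal_inf_adherent => //; rewrite invr_gt0.
  exists (\bigcup_k A k); split => //.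
    exact: bigcupT_measurable.
  apply: le_trans (ltW ltA); apply: measure_sigma_subadditive => //.
  exact: bigcupT_measurable.
have [B hB] := choice cov.
exists (\bigcap_n B n); split.
- by apply: bigcapT_measurable => n; have [] := hB n.
- by move=> x Xx n _; have [_ + _] := hB n; exact.
have mB : measurable (\bigcap_n B n).
  by apply: bigcapT_measurable => n; have [] := hB n.
apply/eqP; rewrite eq_le; apply/andP; split; last first.
  rewrite -(measurable_mu_extE _ mB); apply: le_mu_ext.
  by move=> x Xx n _; have [_ + _] := hB n; exact.
apply/lee_addgt0Pr => e e0.
have [n _ /(_ n (leqnn n)) /= hn] : \forall n \near \oo, (n.+1%:R^-1 < e)%R.
  exact: near_infty_natSinv_lt (PosNum e0).
apply: (@le_trans _ _ (nu (B n))).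
  by apply: le_measure; rewrite ?inE//; [have [] := hB n|move=> x; exact].
have [_ _ /le_trans] := hB n; apply.
by rewrite leeD2l// lee_fin ltW.
Qed.

(** A Caratheodory measurable set splits its measurable hull additively, so the
    part of the hull outside the set has outer measure zero, and a hull of that
    part is the exceptional null set. *)
Lemma caratheodory_ae_measurable (nu : {measure set T -> \bar R})
    (A : set T) : nu setT < +oo ->
  ((nu^*)%mu).-cara.-measurable A ->
  exists B Z, [/\ measurable B, measurable Z, nu Z = 0 &
    forall x, ~ Z x -> A x <-> B x].
Proof.
move=> nuT mA.
have [B [mB AB nuB]] := measurable_hull A nuT.
have [Z [mZ BAZ nuZ]] := measurable_hull (B `\` A) nuT.
have nuB_fin : nu B < +oo.
  by apply: le_lt_trans nuT; apply: le_measure; rewrite ?inE.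
exists B, Z; split => //.
  rewrite nuZ.
  rewrite -[LHS]/(@completed_measure_extension _ _ _ nu (B `\` A)).
  have mB' : ((nu^*)%mu).-cara.-measurable B.
    exact: caratheodory_measurable_mu_ext.
  rewrite measureD//.
    rewrite (setIidr AB)/= /completed_measure_extension -nuB.
    by rewrite measurable_mu_extE// subee// ge0_fin_numE.
  by rewrite /= /completed_measure_extension measurable_mu_extE.
move=> x Zx; split; first exact: AB.
by move=> Bx; apply: contrapT => Ax; apply: Zx; apply: BAZ.
Qed.

(** It is enough to correct the countably many superlevel sets at rational
    heights: the union of the corresponding null sets is still null, and off it
    every superlevel set is a countable union of measurable ones. *)
Lemma caratheodory_fun_ae_measurable (nu : {measure set T -> \bar R})
    (D : set T) (f : T -> R) : nu setT < +oo ->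
  measurable D ->
  measurable_fun (D : set (caratheodory_type (nu^*)%mu)) f ->
  exists Z, [/\ measurable Z, nu Z = 0 & measurable_fun (D `\` Z) f].
Proof.
move=> nuT mD mf.
pose q n : R := ratr (odflt 0%R (@unpickle rat n)).
have hq n : exists BZ : set T * set T, [/\ measurable BZ.1, measurable BZ.2,
    nu BZ.2 = 0 &
    forall x, ~ BZ.2 x -> (D `&` f @^-1` `]q n, +oo[) x <-> BZ.1 x].
  have mDc : ((nu^*)%mu).-cara.-measurable D.
    exact: caratheodory_measurable_mu_ext.
  have := mf mDc _ (measurable_itv `]q n, +oo[).
  by move=> /(caratheodory_ae_measurable nuT)[B [Z ?]]; exists (B, Z).
have [BZ hBZ] := choice hq.
have mZ : measurable (\bigcup_n (BZ n).2).
  by apply: bigcupT_measurable => n; have [] := hBZ n.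
exists (\bigcup_n (BZ n).2); split => //.
  apply/negligibleP => //; apply: negligible_bigcup => n.
  by have [_ mZn Zn0 _] := hBZ n; apply/negligibleP.
move=> _.
apply: (measurability _ (RGenOInfty.measurableE R)); last exact: measurableD.
move=> _ [_ [x ->] <-].
rewrite (_ : _ `&` _ = \bigcup_n ((D `\` \bigcup_n (BZ n).2) `&`
   (if (x < q n)%R then (BZ n).1 else set0))).
  apply: bigcupT_measurable => n; apply: measurableI; first exact: measurableD.
  by case: ifP => // _; have [] := hBZ n.
apply/seteqP; split => z.
  move=> [[Dz Zz]]; rewrite /= in_itv/= andbT => xf.
  have [r] := rat_in_itvoo xf; rewrite in_itv/= => /andP[xr rf].
  have qr : q (pickle r) = ratr r by rewrite /q pickleK.
  exists (pickle r) => //; split; first by split.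
  rewrite qr xr; have [_ _ _ /(_ z)[]] := hBZ (pickle r).
    by move=> h; apply: Zz; exists (pickle r).
  by move=> + _; apply; split => //=; rewrite in_itv/= andbT qr.
move=> [n _ [[Dz Zz]]]; case: ifP => // xq Bz; split => //.
have [_ _ _ /(_ z)[]] := hBZ n.
  by move=> h; apply: Zz; exists n.
move=> _ /(_ Bz)[_] /=; rewrite !in_itv/= !andbT.
exact: lt_trans.
Qed.

Lemma completed_measure_id_measurable (nu : {measure set T -> \bar R}) :
  measurable_fun setT (idfun : caratheodory_type (nu^*)%mu -> T).
Proof.
move=> _ Y mY; rewrite setTI; exact: caratheodory_measurable_mu_ext.
Qed.

Lemma completed_null_measurable (nu : {measure set T -> \bar R}) (Z A : set T) :
  measurable Z -> nu Z = 0 -> A `<=` Z -> ((nu^*)%mu).-cara.-measurable A.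
Proof.
move=> mZ Z0 AZ; apply: measure_is_complete_caratheodory.
exists Z; split => //; first exact: caratheodory_measurable_mu_ext.
by rewrite -Z0 -measurable_mu_extE.
Qed.

(** This lets integrals of kernels that are measurable only after completion be
    computed with the Borel measure itself, where Fubini's theorem applies.
    Completeness makes [f] measurable, as it agrees with [g] off a null set. *)
Lemma integral_completed (nu : {measure set T -> \bar R})
    (f g : T -> \bar R) (Z : set T) :
  measurable Z -> nu Z = 0 -> (forall x, ~ Z x -> f x = g x) ->
  nu.-integrable setT g ->
  \int[@completed_measure_extension _ _ _ nu]_x f x = \int[nu]_x g x.
Proof.
move=> mZ Z0 fg ig.
pose cnu : {measure set (caratheodory_type (nu^*)%mu) -> \bar R} :=
  @completed_measure_extension _ _ _ nu.
have mg : measurable_fun setT g by exact: measurable_int ig.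
pose gc : caratheodory_type (nu^*)%mu -> \bar R := g.
pose fc : caratheodory_type (nu^*)%mu -> \bar R := f.
have mgc : measurable_fun setT gc.
  by apply: (measurableT_comp mg); exact: completed_measure_id_measurable.
have mfc : measurable_fun setT fc.
  move=> _ Y mY; rewrite setTI.
  have -> : fc @^-1` Y = (g @^-1` Y `&` ~` Z) `|` (f @^-1` Y `&` Z).
    apply/seteqP; split => x /=.
      move=> fY; have [Zx|Zx] := pselect (Z x); first by right.
      by left; split => //; rewrite /= -fg.
    by move=> [[gY Zx]|[//]]; rewrite /fc fg.
  apply: measurableU.
    apply: caratheodory_measurable_mu_ext; apply: measurableI.
      by rewrite -[X in measurable X]setTI; exact: mg.
    exact: measurableC.
  by apply: (completed_null_measurable mZ Z0) => x [].
transitivity (\int[cnu]_x gc x).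
  apply: ae_eq_integral => //.
  exists Z; split => /=.
  - exact: caratheodory_measurable_mu_ext.
  - by rewrite /completed_measure_extension measurable_mu_extE.
  - by move=> x /= h; apply: contrapT => Zx; apply: h => _; exact: fg.
(* The completion is carried by a larger sigma-algebra on the same set, so
   that [nu] is the image of its completion under the identity map. *)
have mid := @completed_measure_id_measurable nu.
pose idc : {mfun caratheodory_type (nu^*)%mu >-> T} :=
  HB.pack idfun (isMeasurableFun.Build _ _ _ _ _ mid).
have pE : forall A, measurable A -> A `<=` setT -> pushforward cnu idc A = nu A.
  move=> A mA _.
  by rewrite /pushforward/= /completed_measure_extension measurable_mu_extE.
rewrite -(eq_measure_integral nu pE).
rewrite integral_pushforward//.
rewrite preimage_setT; apply/integrableP; split => //.
have /integrableP[_] := ig; apply: le_lt_trans.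
rewrite -(eq_measure_integral nu pE).
by rewrite ge0_integral_pushforward//; exact: measurableT_comp.
Qed.

End completion.

(** * The Euclidean norm *)

Section euclidean.
Context (R : realType) (n : nat).
Implicit Types x y z u v : 'rV[R]_n.

Definition dotv x y : R := \sum_(i < n) x ord0 i * y ord0 i.

Lemma dotvC x y : dotv x y = dotv y x.
Proof. by apply: eq_bigr => i _; rewrite mulrC. Qed.

Lemma dotvDl x y z : dotv (x + y) z = dotv x z + dotv y z.
Proof. by rewrite -big_split; apply: eq_bigr => i _; rewrite !mxE mulrDl. Qed.

Lemma dotvZl a x y : dotv (a *: x) y = a * dotv x y.
Proof. by rewrite mulr_sumr; apply: eq_bigr => i _; rewrite !mxE mulrA. Qed.

Lemma dotvDr x y z : dotv z (x + y) = dotv z x + dotv z y.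
Proof. by rewrite dotvC dotvDl !(dotvC z). Qed.

Lemma dotvZr a x y : dotv y (a *: x) = a * dotv y x.
Proof. by rewrite dotvC dotvZl dotvC. Qed.

Lemma dotvNl x y : dotv (- x) y = - dotv x y.
Proof. by rewrite -scaleN1r dotvZl mulN1r. Qed.

Lemma dotvNr x y : dotv y (- x) = - dotv y x.
Proof. by rewrite dotvC dotvNl dotvC. Qed.

Lemma dotvv_ge0 x : 0 <= dotv x x.
Proof. by apply: sumr_ge0 => i _; rewrite -expr2 sqr_ge0. Qed.

Lemma enormE x : enorm x = Num.sqrt (dotv x x).
Proof. by congr Num.sqrt; apply: eq_bigr => i _; rewrite expr2. Qed.

Lemma sqr_enorm x : enorm x ^+ 2 = dotv x x.
Proof. by rewrite enormE sqr_sqrtr// dotvv_ge0. Qed.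

Lemma pythagoras u v : dotv u v = 0 ->
  dotv (u + v) (u + v) = dotv u u + dotv v v.
Proof. by move=> uv; rewrite dotvDl !dotvDr (dotvC v u) uv addr0 add0r. Qed.

Lemma enorm_ge0 x : 0 <= enorm x. Proof. exact: sqrtr_ge0. Qed.

Lemma enormN x : enorm (- x) = enorm x.
Proof. by rewrite !enormE dotvNl dotvNr opprK. Qed.

Lemma enormB x y : enorm (x - y) = enorm (y - x).
Proof. by rewrite -enormN opprB. Qed.

Lemma ler_coord_enorm x i : `|x ord0 i| <= enorm x.
Proof.
rewrite -sqrtr_sqr; apply: ler_wsqrtr; rewrite (bigD1 i)//= lerDl.
by apply: sumr_ge0 => j _; exact: sqr_ge0.
Qed.

Lemma enorm_eq0 x : (enorm x == 0) = (x == 0).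
Proof.
apply/eqP/eqP => [x0|->]; last first.
  by rewrite enormE /dotv big1 ?sqrtr0// => i _; rewrite mxE mul0r.
apply/rowP => i; rewrite mxE; apply/eqP; rewrite -normr_le0 -x0.
exact: ler_coord_enorm.
Qed.

Lemma enorm_gt0 x : (0 < enorm x) = (x != 0).
Proof. by rewrite lt_neqAle enorm_ge0 andbT eq_sym enorm_eq0. Qed.

Lemma enormZ a x : enorm (a *: x) = `|a| * enorm x.
Proof.
by rewrite !enormE dotvZl dotvZr mulrA -expr2 sqrtrM ?sqr_ge0// sqrtr_sqr.
Qed.

(** Expand the square of the norm of [(y . y) x - (x . y) y], which is
    nonnegative. *)
Lemma cauchy_schwarz x y : `|dotv x y| <= enorm x * enorm y.
Proof.
have [/eqP|y0] := eqVneq (enorm y) 0.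
  rewrite enorm_eq0 => /eqP ->; rewrite /dotv big1 ?normr0 ?mulr_ge0 ?enorm_ge0//.
  by move=> i _; rewrite mxE mulr0.
have y_gt0 : 0 < dotv y y by rewrite -sqr_enorm exprn_gt0// lt_def y0 enorm_ge0.
rewrite -sqrtr_sqr !enormE -sqrtrM ?dotvv_ge0//; apply: ler_wsqrtr.
have := dotvv_ge0 (dotv y y *: x - dotv x y *: y).
rewrite !(dotvDl, dotvDr, dotvNl, dotvNr, dotvZl, dotvZr) (dotvC y x) => h.
rewrite -(ler_pM2l y_gt0); move: h; set a := dotv y y; set b := dotv x y.
set c := dotv x x; nra.
Qed.

Lemma ler_enormD x y : enorm (x + y) <= enorm x + enorm y.
Proof.
rewrite -(@ler_pXn2r _ 2)// ?nnegrE ?addr_ge0 ?enorm_ge0//.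
rewrite sqr_enorm !(dotvDl, dotvDr) (dotvC y x) sqrrD !sqr_enorm.
have := le_trans (ler_norm _) (cauchy_schwarz x y).
lra.
Qed.

Lemma ler_enorm_trans x y z : enorm (x - z) <= enorm (x - y) + enorm (y - z).
Proof. by rewrite -(subrKA y) ler_enormD. Qed.

Lemma ler_dist_enorm x y : `|enorm x - enorm y| <= enorm (x - y).
Proof.
have h u v : enorm u - enorm v <= enorm (u - v).
  by rewrite lerBlDr; have := ler_enormD (u - v) v; rewrite subrK.
by rewrite ler_norml h andbT lerNl opprB (le_trans (h y x))// enormB.
Qed.

Lemma ler_enorm_sum x : enorm x <= \sum_(i < n) `|x ord0 i|.
Proof.
have s0 : 0 <= \sum_(i < n) `|x ord0 i| by exact: sumr_ge0.
rewrite -(@ler_pXn2r _ 2)// ?nnegrE ?enorm_ge0// sqr_enorm expr2 mulr_suml.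
apply: ler_sum => i _; rewrite -expr2 -real_normK ?num_real// expr2.
apply: ler_wpM2l => //; rewrite (bigD1 i)//= lerDl.
by apply: sumr_ge0.
Qed.

Lemma ler_enorm_norm x : enorm x <= n%:R * `|x|.
Proof.
apply: (le_trans (ler_enorm_sum x)).
rewrite -[n in n%:R]card_ord -sum1_card natr_sum mulr_suml.
apply: ler_sum => i _; rewrite mul1r [`|x|]/Num.norm/= mx_normrE.
exact: (le_bigmax _ (fun ij : 'I_1 * 'I_n => `|x ij.1 ij.2|) (ord0, i)).
Qed.

Lemma ler_norm_enorm x : `|x| <= enorm x.
Proof.
rewrite [leLHS]/Num.norm/= mx_normrE; apply/bigmax_leP; split; first exact: enorm_ge0.
by move=> [i j] _ /=; rewrite (ord1 i) ler_coord_enorm.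
Qed.

End euclidean.

(** * Decay of a porous set near a hypersurface *)

Section sheet.
Context (R : realType) (d : nat) (i : 'I_d.+1).
Variables (G : set 'rV[R]_d.+1) (F : 'rV[R]_d.+1 -> R).

(** One should think of [F] as a defining function of a hypersurface that is,
    inside [G], a graph over the [d] coordinates other than the [i]-th one.
    Only these coordinates are subdivided, so that a patch has [N ^ d]
    children, in accordance with the growth exponent of the measure. *)
Definition patch (a : 'I_d -> R) (l w : R) : set 'rV[R]_d.+1 :=
  [set x | [/\ G x, forall j, a j <= x ord0 (lift i j) <= a j + l
             & `|F x| <= w]].

Definition subcorner N (a : 'I_d -> R) (s : R) (t : {ffun 'I_d -> 'I_N}) :
  'I_d -> R := fun j => a j + (t j)%:R * s.

Lemma grid_index N (s u : R) : (0 < N)%N -> 0 <= u <= N%:R * s ->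
  exists t : 'I_N, t%:R * s <= u <= t%:R * s + s.
Proof.
move=> N0 /andP[u0 uN].
have ex : exists k : nat, u <= k.+1%:R * s by exists N.-1; rewrite prednK.
have := ex_minnP ex; case: ex_minnP => k uk mink _.
have kN : (k < N)%N.
  by have := mink N.-1; rewrite prednK// => /(_ uN); rewrite -ltnS prednK.
rewrite -natr1 mulrDl mul1r in uk.
exists (Ordinal kN) => /=; rewrite {}uk andbT.
case: k mink {kN} => [|k] mink; first by rewrite mul0r.
by rewrite leNgt; apply/negP => /ltW /mink; rewrite ltnn.
Qed.

Lemma patch_cover N a s w : (0 < N)%N ->
  patch a (N%:R * s) w `<=`
  \bigcup_(t in [set: {ffun 'I_d -> 'I_N}]) patch (subcorner a s t) s w.
Proof.
move=> N0 x [Gx ax Fx].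
have h j : exists t : 'I_N,
    t%:R * s <= x ord0 (lift i j) - a j <= t%:R * s + s.
  by apply: grid_index => //; have := ax j; lra.
have [t ht] := choice h.
exists [ffun j => t j] => //; split => // j.
by rewrite /subcorner ffunE; have := ht j; lra.
Qed.

Variables (G' : set 'rV[R]_d.+1) (L : R).
Hypotheses (L0 : 0 < L) (GG' : G `<=` G').
(* The hypersurface is a Lipschitz graph, uniformly for all values of [F]. *)
Hypothesis FL : forall x z e, G' x -> G z -> 0 <= e ->
  (forall j, `|x ord0 (lift i j) - z ord0 (lift i j)| <= e) ->
  enorm (x - z) <= L * (e + `|F x - F z|).

Variables (E : set 'rV[R]_d.+1) (c r0 : R).
Hypotheses (c0 : 0 < c) (r00 : 0 < r0).
(* Porosity of [E] along the hypersurface: the centre of the hole stays so close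
   to the level set of [F] through [x] that the hole contains a whole patch. *)
Hypothesis holes : forall x r, E x -> G x -> 0 < r -> r <= r0 ->
  exists y, [/\ G' y, eball y (c * r) `<=` eball x r `\` E &
                `|F y - F x| <= c * r / (4 * L)].

(** Cut the projection of a patch into [N ^ d] cells with [N = 2 M + 1]. If the
    central cell meets [E] at [x], then the ball about [x] of radius [M] cells
    projects into the patch, and the hole that it contains has radius [c M]
    cells, which by the Lipschitz bound exceeds the distance from its centre to
    any point of the child over the cell below that centre. *)
Lemma patch_hole M a s w : (0 < M)%N -> 4 * L <= c * M%:R ->
  0 < s -> (M.*2.+1)%:R * s <= r0 -> w <= s ->
  exists t : {ffun 'I_d -> 'I_M.*2.+1},
    patch (subcorner a s t) s w `&` E = set0.
Proof.
move=> M0 cM s0 sr ws.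
have MN : (M < M.*2.+1)%N by rewrite ltnS -addnn leq_addr.
pose mid : {ffun 'I_d -> 'I_M.*2.+1} := [ffun=> Ordinal MN].
have [mid0|/set0P[x [[Gx ax Fx] Ex]]] :=
  eqVneq (patch (subcorner a s mid) s w `&` E) set0; first by exists mid.
have NE : (M.*2.+1)%:R = 2 * M%:R + 1 :> R by rewrite -natr1 -muln2 natrM; lra.
have M1 : 1 <= M%:R :> R by rewrite ler1n.
have r_gt0 : 0 < M%:R * s by rewrite mulr_gt0// (lt_le_trans ltr01).
have rr0 : M%:R * s <= r0 by apply: le_trans sr; rewrite ler_pM2r// NE; lra.
have [y [G'y yE Fy]] := holes Ex Gx r_gt0 rr0.
have yx : enorm (y - x) <= M%:R * s.
  have [] // : (eball x (M%:R * s) `\` E) y.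
  apply: yE; rewrite /eball/= subrr.
  have /eqP -> : enorm (0 : 'rV[R]_d.+1) == 0 by rewrite enorm_eq0.
  by rewrite mulr_ge0 ?ltW// mulr_gt0.
have h j : exists t : 'I_M.*2.+1,
    t%:R * s <= y ord0 (lift i j) - a j <= t%:R * s + s.
  apply: grid_index => //.
  have := ax j; rewrite /subcorner ffunE/= => ax'.
  have := le_trans (ler_coord_enorm (y - x) (lift i j)) yx.
  by rewrite !mxE ler_norml NE; lra.
have [t ht] := choice h.
exists [ffun j => t j]; apply/seteqP; split => // z [[Gz az Fz] Ez].
suff : eball y (c * (M%:R * s)) z by move=> /yE[].
rewrite /eball/= enormB.
have : enorm (y - z) <= L * (s + `|F y - F z|).
  apply: FL => //; first exact: ltW.
  move=> j; have := az j; rewrite /subcorner ffunE; have := ht j.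
  by rewrite ler_norml; lra.
move=> /le_trans; apply.
have FyFz : `|F y - F z| <= c * (M%:R * s) / (4 * L) + 2 * s.
  rewrite -(subrKA (F x)); apply: (le_trans (ler_normD _ _)); apply: lerD => //.
  by apply: (le_trans (ler_normB _ _)); lra.
apply: (@le_trans _ _ (L * (s + (c * (M%:R * s) / (4 * L) + 2 * s)))).
  by rewrite ler_pM2l// lerD2l.
have -> : L * (s + (c * (M%:R * s) / (4 * L) + 2 * s)) =
    3 * L * s + c * (M%:R * s) / 4.
  by field; rewrite gt_eqF.
have : 4 * L * s <= c * M%:R * s by rewrite ler_pM2r.
by lra.
Qed.

Variables (m : set 'rV[R]_d.+1 -> R) (C : R).
Hypothesis m_le : forall A B, A `<=` B -> m A <= m B.
Hypothesis m_bigcup : forall (I : finType) (A : I -> set 'rV[R]_d.+1),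
  m (\bigcup_(t in [set: I]) A t) <= \sum_t m (A t).
Hypothesis m_null : forall A, A `&` E = set0 -> m A = 0.
Hypothesis m_ball : forall x r, E x -> 0 < r -> m (eball x r) <= C * r ^+ d.

(** A patch as thick as it is wide lies in a ball of comparable radius. *)
Lemma patch_ball a l : 0 < l -> m (patch a l l) <= `|C| * (3 * L) ^+ d * l ^+ d.
Proof.
move=> l0.
have [/m_null ->|/set0P[x [[Gx ax Fx] Ex]]] := eqVneq (patch a l l `&` E) set0.
  by rewrite !mulr_ge0 ?exprn_ge0// ltW// mulr_gt0.
have r_gt0 : 0 < 3 * L * l by rewrite !mulr_gt0.
rewrite -mulrA -exprMn.
apply: (@le_trans _ _ (C * (3 * L * l) ^+ d)); last first.
  by rewrite ler_wpM2r ?ler_norm// exprn_ge0// ltW.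
apply: le_trans (m_ball Ex r_gt0); apply: m_le => z [Gz az Fz].
rewrite /eball/= enormB; apply: (@le_trans _ _ (L * (l + `|F x - F z|))).
  apply: FL => //; [exact: GG'|exact: ltW|].
  by move=> j; have := az j; have := ax j; rewrite ler_norml; lra.
rewrite (_ : 3 * L * l = L * (3 * l)); last by ring.
rewrite ler_pM2l//.
by have := ler_normB (F x) (F z); lra.
Qed.

(** When the thickness is divided by [N], one of the [N ^ d] children of a
    patch misses [E]. The remaining ones have their side divided by [N], so
    that their total mass is at most [(N ^ d - 1) / N ^ d] times the bound for
    the parent; the exponent [d] of the growth condition exactly balances the
    number of children. *)
Lemma patch_tree M : (0 < M)%N -> 4 * L <= c * M%:R ->
  let N := M.*2.+1 in let theta := 1 - (N%:R ^+ d)^-1 in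
  forall k a l, 0 < l -> l <= r0 ->
  m (patch a l (l / N%:R ^+ k)) <= `|C| * (3 * L) ^+ d * l ^+ d * theta ^+ k.
Proof.
move=> M0 cM N theta; have N0 : 0 < N%:R :> R by rewrite ltr0n.
have Nd0 : 0 < N%:R ^+ d :> R by rewrite exprn_gt0.
elim=> [|k IHk] a l l0 lr0.
  by rewrite !expr0 divr1 mulr1; exact: patch_ball.
pose s := l / N%:R; have s0 : 0 < s by rewrite divr_gt0.
have lE : l = N%:R * s by rewrite mulrC divfK ?gt_eqF.
have wE : l / N%:R ^+ k.+1 = s / N%:R ^+ k by rewrite /s exprS invfM mulrA.
have sr0 : s <= r0.
  apply: le_trans lr0; rewrite ler_pdivrMr// ler_peMr ?(ltW l0)//.
  by rewrite ler1n.
have ws : s / N%:R ^+ k <= s.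
  by rewrite ler_pdivrMr ?exprn_gt0// ler_peMr ?(ltW s0)// exprn_ege1// ler1n.
have [t0 /m_null ht0] : exists t : {ffun 'I_d -> 'I_N},
    patch (subcorner a s t) s (s / N%:R ^+ k) `&` E = set0.
  by apply: patch_hole => //; rewrite -/N -lE.
rewrite wE.
apply: (@le_trans _ _ (\sum_(t : {ffun 'I_d -> 'I_N})
    m (patch (subcorner a s t) s (s / N%:R ^+ k)))).
  apply: le_trans (m_bigcup _); apply: m_le.
  by rewrite {1}lE; exact: patch_cover.
rewrite (bigD1 t0)//= ht0 add0r.
apply: (@le_trans _ _ (\sum_(t : {ffun 'I_d -> 'I_N} | t != t0)
    `|C| * (3 * L) ^+ d * s ^+ d * theta ^+ k)).
  by apply: ler_sum => t _; exact: IHk.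
rewrite sumr_const.
have -> : #|[pred t | t != t0]| = (N ^ d).-1.
  by rewrite cardC1 card_ffun !card_ord.
rewrite -[leLHS]mulr_natr -subn1 natrB ?expn_gt0// natrX.
rewrite [leRHS](_ : _ = `|C| * (3 * L) ^+ d * s ^+ d * theta ^+ k *
    (N%:R ^+ d * theta)).
  rewrite le_eqVlt; apply/orP; left; apply/eqP; congr (_ * _).
  by rewrite /theta mulrBr mulr1 divff ?gt_eqF.
have -> : l ^+ d = N%:R ^+ d * s ^+ d by rewrite {1}lE exprMn.
by rewrite exprSr; ring.
Qed.

(** The restriction to sides at most [r0] is removed by covering a large patch
    with boundedly many small ones. *)
Lemma patch_decay a l : 0 < l -> exists N A s theta,
  [/\ (1 < N)%N, 0 <= A, 0 < s & 0 <= theta < 1] /\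
  forall k, m (patch a l (s / N%:R ^+ k)) <= A * theta ^+ k.
Proof.
move=> l0.
pose M := (Num.bound (4 * L / c)).+1.
have cM : 4 * L <= c * M%:R.
  rewrite [leRHS]mulrC -ler_pdivrMr//; apply: le_trans (ltW (archi_boundP _)) _.
    by rewrite divr_ge0 ?mulr_ge0 ?ltW.
  by rewrite ler_nat.
pose N := M.*2.+1; pose theta : R := 1 - (N%:R ^+ d)^-1.
have tree k b r : 0 < r -> r <= r0 ->
    m (patch b r (r / N%:R ^+ k)) <= `|C| * (3 * L) ^+ d * r ^+ d * theta ^+ k.
  exact: patch_tree.
have Nd1 : 1 <= N%:R ^+ d :> R by rewrite exprn_ege1// ler1n.
pose Q := (Num.bound (l / r0)).+1; pose s := l / Q%:R.
have Q0 : 0 < Q%:R :> R by rewrite ltr0n.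
have s0 : 0 < s by rewrite divr_gt0.
have sr0 : s <= r0.
  rewrite /s ler_pdivrMr// mulrC -ler_pdivrMr//.
  apply: le_trans (ltW (archi_boundP _)) _; first by rewrite divr_ge0 ?ltW.
  by rewrite ler_nat.
exists N, ((Q ^ d)%:R * (`|C| * (3 * L) ^+ d * s ^+ d)), s, theta; split.
  split => //.
    by rewrite !mulr_ge0 ?exprn_ge0 ?(ltW s0)// mulr_ge0 ?ltW.
  rewrite /theta subr_ge0 invf_le1 ?Nd1 ?(lt_le_trans ltr01 Nd1)//=.
  by rewrite ltrBlDr ltrDl invr_gt0 (lt_le_trans ltr01 Nd1).
move=> k.
apply: (@le_trans _ _ (\sum_(t : {ffun 'I_d -> 'I_Q})
    m (patch (subcorner a s t) s (s / N%:R ^+ k)))).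
  apply: le_trans (m_bigcup _); apply: m_le.
  rewrite {1}(_ : l = Q%:R * s); last by rewrite mulrC divfK ?gt_eqF.
  exact: patch_cover.
apply: (@le_trans _ _ (\sum_(t : {ffun 'I_d -> 'I_Q})
    `|C| * (3 * L) ^+ d * s ^+ d * theta ^+ k)).
  by apply: ler_sum => t _; exact: tree.
rewrite sumr_const -[leLHS]mulr_natl.
have -> : #|{: {ffun 'I_d -> 'I_Q}}| = (Q ^ d)%N by rewrite card_ffun !card_ord.
by rewrite mulrA.
Qed.

End sheet.

(** * Borel measurability and the support *)

Lemma measurable_le_set d (T : measurableType d) (R : realType) (f g : T -> R) :
  measurable_fun setT f -> measurable_fun setT g ->
  measurable [set x | f x <= g x].
Proof.
move=> mf mg.
have := measurable_funB mg mf; move=> /(_ measurableT _ (measurable_itv `[0, +oo[)).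
rewrite setTI; congr (measurable _); apply/seteqP; split => x /=.
  by rewrite in_itv/= andbT subr_ge0.
by rewrite in_itv/= andbT subr_ge0.
Qed.

Lemma measurable_lt_set d (T : measurableType d) (R : realType) (f g : T -> R) :
  measurable_fun setT f -> measurable_fun setT g ->
  measurable [set x | f x < g x].
Proof.
move=> mf mg; have := measurableC (measurable_le_set mg mf).
by congr (measurable _); apply/seteqP; split => x /=; rewrite ltNge => /negP.
Qed.

Section borel.
Context (R : realType) (n : nat).
Let T := borelRn R n.

Lemma continuous_borel (f : 'rV[R]_n -> R) :
  continuous f -> measurable_fun setT (f : T -> R).
Proof.
move=> cf _; apply: (measurability _ (RGenOpens.measurableE R)) => //.
move=> _ [_ [a [b ->]] <-]; rewrite setTI; apply: sub_sigma_algebra.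
by move/continuousP : cf; apply; exact: interval_open.
Qed.

Lemma open_borel (U : set 'rV[R]_n) : open U -> measurable (U : set T).
Proof. by move=> oU; exact: sub_sigma_algebra. Qed.

Lemma closed_borel (U : set 'rV[R]_n) : closed U -> measurable (U : set T).
Proof.
move=> cU; rewrite -[U]setCK; apply: measurableC.
by apply: open_borel; exact: closed_openC.
Qed.

Lemma measurable_coord (i : 'I_n) : measurable_fun setT (fun x : T => x ord0 i : R).
Proof. by apply: continuous_borel => x; exact: coord_continuous. Qed.

Lemma measurable_sqrt : measurable_fun setT (@Num.sqrt R).
Proof. by apply: continuous_measurable_fun; exact: sqrt_continuous. Qed.

Lemma measurable_enorm_comp d (X : measurableType d) (f : X -> 'rV[R]_n) :
  (forall i, measurable_fun setT (fun x => f x ord0 i : R)) ->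
  measurable_fun setT (fun x => enorm (f x)).
Proof.
move=> mf; apply: (measurableT_comp measurable_sqrt).
by apply: measurable_sum => i; apply: measurable_funX; exact: mf.
Qed.

Lemma measurable_dist :
  measurable_fun setT (fun p : T * T => enorm ((p.1 : 'rV[R]_n) - p.2) : R).
Proof.
apply: measurable_enorm_comp => i.
under eq_fun do rewrite !mxE.
apply: measurable_funB.
  exact: (measurableT_comp (measurable_coord i) measurable_fst).
exact: (measurableT_comp (measurable_coord i) measurable_snd).
Qed.

Lemma measurable_eball (x : 'rV[R]_n) r : measurable (eball x r : set T).
Proof.
apply: measurable_le_set; last exact: measurable_cst.
apply: measurable_enorm_comp => i; under eq_fun do rewrite !mxE.
by apply: measurable_funB => //; exact: measurable_coord.
Qed.

Lemma measurable_cube (x : 'rV[R]_n) r : measurable (cube x r : set T).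
Proof.
rewrite (_ : cube x r = \bigcap_(i in [set: 'I_n])
   ([set y : T | x ord0 i - r / 2 <= y ord0 i] `&`
    [set y : T | y ord0 i < x ord0 i + r / 2])); last first.
  apply/seteqP; split => y h i; first by move=> _; apply/andP; exact: h.
  by have [] := h i I; rewrite /= => -> ->.
apply: fin_bigcap_measurable => //.
move=> i _; apply: measurableI.
  by apply: measurable_le_set => //; exact: measurable_coord.
by apply: measurable_lt_set => //; exact: measurable_coord.
Qed.

End borel.

Section support.
Context (R : realType) (n : nat).
Let T := borelRn R n.
Variable (mu : {finite_measure set T -> \bar R}).

Lemma closed_spt : closed (spt mu).
Proof. by apply: closed_bigI => F []. Qed.

(** An uncountable union of open null sets need not be null in general: inner
    regularity reduces the claim to compact sets, which are covered by finitely
    many of these open sets. *)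
Lemma spt_null : radon mu -> mu (~` spt mu) = 0%E.
Proof.
move=> [_ inner _].
rewrite inner; last by apply: closed_openC; exact: closed_spt.
apply/eqP; rewrite eq_le; apply/andP; split; last first.
  by apply: ereal_sup_ubound; exists set0; rewrite ?measure0//=; split => //; exact: compact0.
apply: ge_ereal_sup => _ [K [cK Kspt] <-].
have mK : measurable (K : set T).
  by apply: closed_borel; apply: compact_closed => //; exact: norm_hausdorff.
move: cK; rewrite compact_cover => /(_ (set 'rV[R]_n)
  [set F | closed F /\ mu (~` F) = 0%E] (fun F => ~` F)) [].
- by move=> F [cF _]; exact: closed_openC.
- by rewrite /cover -setC_bigcap.
move=> D DF KD; suff negK : mu.-negligible K.
  by rewrite (measure_negligible mK negK).
apply: (@negligibleS _ _ _ mu _ _ KD); rewrite /cover bigcup_fset big_seq.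
elim/big_ind : _ => [|A B|F /DF].
- exact: negligible_set0.
- exact: negligibleU.
rewrite inE => -[cF F0]; apply/negligibleP; last exact: F0.
by apply: open_borel; exact: closed_openC.
Qed.

End support.

(** * Integrability near a thin sheet *)

Section mass.
Context (R : realType) (n : nat).
Let T := borelRn R n.
Variable (mu : {finite_measure set T -> \bar R}).

(** The outer measure, as a real number, is used for the sets in the covering
    argument so that their measurability need not be tracked. *)
Definition mass (A : set 'rV[R]_n) : R := fine ((mu^*)%mu A).

Lemma EFin_mass A : (mass A)%:E = (mu^*)%mu A.
Proof.
rewrite /mass fineK// ge0_fin_numE ?mu_ext_ge0//.
apply: (@le_lt_trans _ _ ((mu^*)%mu setT)); first exact: le_mu_ext.
by rewrite measurable_mu_extE// -ge0_fin_numE// fin_num_measure.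
Qed.

Lemma massE (A : set T) : measurable A -> (mass A)%:E = mu A.
Proof. by move=> mA; rewrite EFin_mass measurable_mu_extE. Qed.

Lemma mass_ge0 A : 0 <= mass A.
Proof. by rewrite -lee_fin EFin_mass mu_ext_ge0. Qed.

Lemma mass_le A B : A `<=` B -> mass A <= mass B.
Proof. by move=> AB; rewrite -lee_fin !EFin_mass; exact: le_mu_ext. Qed.

Lemma mass_bigcup (I : finType) (A : I -> set 'rV[R]_n) :
  mass (\bigcup_(t in [set: I]) A t) <= \sum_t mass (A t).
Proof.
rewrite (_ : [set: I] = [set` index_enum I]); last first.
  by apply/seteqP; split => t //= _; rewrite mem_index_enum.
rewrite bigcup_seq; elim/big_ind2 : _ => //.
  by rewrite -lee_fin EFin_mass mu_ext0.
move=> B b D e Bb De; apply: le_trans (lerD Bb De).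
rewrite -lee_fin EFinD !EFin_mass; exact: (outer_measureU2 (mu^*)%mu).
Qed.

Lemma mass_null A : radon mu -> A `&` spt mu = set0 -> mass A = 0.
Proof.
move=> rmu A0; apply/eqP; rewrite eq_le mass_ge0 andbT.
have AS : A `<=` ~` spt mu.
  by move=> x Ax sx; have : (A `&` spt mu) x by []; rewrite A0.
apply: (le_trans (mass_le AS)).
rewrite -lee_fin massE ?spt_null//.
by apply: open_borel; apply: closed_openC; exact: closed_spt.
Qed.

End mass.

Lemma sum_geometric_le (R : realType) (theta : R) k : 0 <= theta < 1 ->
  \sum_(0 <= j < k) theta ^+ j <= (1 - theta)^-1.
Proof.
move=> /andP[t0 t1]; have t2 : 0 < 1 - theta by rewrite subr_gt0.
suff -> : \sum_(0 <= j < k) theta ^+ j = (1 - theta ^+ k) / (1 - theta).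
  by rewrite ler_piMl ?invr_ge0 ?(ltW t2)// lerBlDr lerDl exprn_ge0.
elim: k => [|k IHk]; first by rewrite big_nil expr0 subrr mul0r.
rewrite big_nat_recr//= IHk exprS; field.
by rewrite gt_eqF.
Qed.

Lemma measurable_box (R : realType) (d : nat) (i : 'I_d.+1) (a : 'I_d -> R)
    (l : R) :
  measurable ([set x | forall j, a j <= x ord0 (lift i j) <= a j + l] :
    set (borelRn R d.+1)).
Proof.
rewrite [X in measurable X](_ : _ = \bigcap_(j in [set: 'I_d])
   ([set x : borelRn R d.+1 | a j <= x ord0 (lift i j)] `&`
    [set x : borelRn R d.+1 | x ord0 (lift i j) <= a j + l])); last first.
  apply/seteqP; split => x h j; first by move=> _; apply/andP; exact: h.
  by have [] := h j I; rewrite /= => -> ->.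
apply: fin_bigcap_measurable => // j _; apply: measurableI.
  by apply: measurable_le_set => //; exact: measurable_coord.
by apply: measurable_le_set => //; exact: measurable_coord.
Qed.

Section sheet_integrable.
Local Open Scope ereal_scope.
Context (R : realType) (d : nat) (i : 'I_d.+1).
Let T := borelRn R d.+1.
Variables (mu : {finite_measure set T -> \bar R}).
Hypothesis rmu : radon mu.
Variables (C : R).
Hypothesis hgrowth : forall (x : 'rV[R]_d.+1) (r : R), spt mu x -> (0 < r)%R ->
  mu (eball x r) <= (C * r ^+ d)%:E.
Hypothesis d0 : (0 < d)%N.

Variables (G : set 'rV[R]_d.+1) (F : 'rV[R]_d.+1 -> R).
Hypotheses (mG : measurable (G : set T)) (mF : measurable_fun setT (F : T -> R)).

Lemma measurable_patch a l w : measurable (patch i G F a l w : set T).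
Proof.
rewrite (_ : patch i G F a l w = (G : set T) `&`
   ([set x : T | forall j, a j <= x ord0 (lift i j) <= a j + l]%R `&`
    [set x : T | `|F x| <= w]%R)); last first.
  by apply/seteqP; split => x; [move=> []|move=> [? []]].
apply: measurableI => //; apply: measurableI; first exact: measurable_box.
by apply: measurable_le_set => //; exact: measurableT_comp.
Qed.

Let strip a l w : set (T * T) :=
  [set p | patch i G F a l w p.1 /\ (enorm ((p.1 : 'rV[R]_d.+1) - p.2) <= w)%R].

Lemma measurable_strip a l w : measurable (strip a l w).
Proof.
rewrite (_ : strip a l w = (patch i G F a l w `*` setT) `&`
  [set p : T * T | (enorm ((p.1 : 'rV[R]_d.+1) - p.2) <= w)%R]); last first.
  by apply/seteqP; split => p /=; [move=> [? ?]|move=> [[? ?] ?]].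
apply: measurableI.
  by apply: measurableX => //; exact: measurable_patch.
by apply: measurable_le_set => //; exact: measurable_dist.
Qed.

(** For almost every [x] the growth condition bounds the mass of the ball of
    radius [w] about [x]; integrate this over the patch. *)
Lemma strip_measure a l w : (0 < w)%R ->
  (mu \x mu) (strip a l w) <= (`|C| * w ^+ d * mass mu (patch i G F a l w))%:E.
Proof.
move=> w0.
have mP := measurable_patch a l w.
rewrite EFinM massE//.
have -> : mu (patch i G F a l w) = \int[mu]_x (\1_(patch i G F a l w) x)%:E.
  by rewrite integral_indic// setIT.
rewrite -ge0_integralZl_EFin//; last 2 first.
- by apply/measurable_EFinP; exact: measurable_indic.
- by rewrite mulr_ge0// exprn_ge0// ltW.
apply: ae_ge0_le_integral => //.
- by apply: measurable_fun_xsection; exact: measurable_strip.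
- by move=> x _; rewrite -EFinM lee_fin !mulr_ge0// exprn_ge0// ltW.
- by apply: measurable_funeM; apply/measurable_EFinP; exact: measurable_indic.
exists (~` spt mu); split.
- by apply: open_borel; apply: closed_openC; exact: closed_spt.
- exact: spt_null.
move=> x /= h sx; apply: h => _.
have [Px|Px] := pselect (patch i G F a l w x); last first.
  rewrite (_ : xsection _ _ = set0) ?measure0 ?mule_ge0//.
    by rewrite lee_fin mulr_ge0// exprn_ge0// ltW.
  by apply/seteqP; split => y //; rewrite /xsection/= inE => -[].
rewrite indicE mem_set// mule1.
apply: (@le_trans _ _ (mu (eball x w))).
  apply: le_measure; rewrite ?inE.
  - by apply: measurable_xsection; exact: measurable_strip.
  - exact: measurable_eball.
  - by move=> y; rewrite /xsection/= inE => -[_]; rewrite /eball/= enormB.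
apply: (le_trans (hgrowth sx w0)); rewrite lee_fin ler_wpM2r ?ler_norm//.
by rewrite exprn_ge0// ltW.
Qed.

(** The multiscale estimate behind the theorem. Where the distance of [p.1] and
    [p.2] is about [s / N ^ k], the function [h] is at most a multiple of
    [(s / N ^ k) ^- d], while the set of these pairs has measure at most a
    multiple of [(s / N ^ k) ^+ d] times the mass of a patch of thickness
    [s / N ^ k]. The powers cancel and the masses of the patches form a
    convergent geometric series. *)
Lemma sheet_integrable (a : 'I_d -> R) (l : R) (N : nat) (A s theta B : R)
    (h : T * T -> R) :
  (1 < N)%N -> (0 <= A)%R -> (0 < s)%R -> (0 <= theta < 1)%R ->
  (forall k, mass mu (patch i G F a l (s / N%:R ^+ k)) <= A * theta ^+ k)%R ->
  measurable_fun setT h -> (0 <= B)%R ->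
  (forall p, `|h p| <= B * enorm ((p.1 : 'rV[R]_d.+1) - p.2) ^- d)%R ->
  (forall p, h p != 0%R -> [/\ G p.1,
     (forall j, a j <= (p.1 : 'rV[R]_d.+1) ord0 (lift i j) <= a j + l)%R &
     (`|F p.1| <= enorm ((p.1 : 'rV[R]_d.+1) - p.2))%R]) ->
  (mu \x mu).-integrable setT (EFin \o h).
Proof.
move=> N1 A0 s0 th01 decay mh B0 hB hsub.
have Ngt0 : (0 < N%:R :> R)%R by rewrite ltr0n (ltn_trans _ N1).
pose sk k : R := (s / N%:R ^+ k)%R.
have sk0 k : (0 < sk k)%R by rewrite divr_gt0// exprn_gt0.
pose b k : R := (B * (sk k.+1) ^- d)%R.
have b0 k : (0 <= b k)%R by rewrite mulr_ge0// invr_ge0 exprn_ge0// ltW.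
pose D k := strip a l (sk k).
have mD k : measurable (D k) by exact: measurable_strip.
have mbD k : measurable_fun setT (fun p => (b k)%:E * (\1_(D k) p)%:E).
  by apply: measurable_funeM; apply/measurable_EFinP; exact: measurable_indic.
have bD0 k (p : T * T) : setT p -> 0 <= (b k)%:E * (\1_(D k) p)%:E.
  by move=> _; rewrite -EFinM lee_fin mulr_ge0.
apply/integrableP; split; first exact/measurable_EFinP.
pose g p := (B * s ^- d)%:E + \sum_(0 <= k <oo) ((b k)%:E * (\1_(D k) p)%:E).
have Bs0 : (0 <= B * s ^- d)%R by rewrite mulr_ge0// invr_ge0 exprn_ge0// ltW.
have ser0 p : 0 <= \sum_(0 <= k <oo) ((b k)%:E * (\1_(D k) p)%:E).
  by apply: nneseries_ge0 => k _ _; exact: bD0.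
have mser : measurable_fun setT
    (fun p => \sum_(0 <= k <oo) ((b k)%:E * (\1_(D k) p)%:E)).
  by apply: ge0_emeasurable_sum => // k p _ _; exact: bD0.
have hg p : `|(EFin \o h) p| <= g p.
  have [hp0|hp0] := eqVneq (h p) 0%R.
    by rewrite /= hp0 normr0 adde_ge0.
  set e := enorm ((p.1 : 'rV[R]_d.+1) - p.2).
  have hBe : (`|h p| <= B * e ^- d)%R by exact: hB.
  have e0 : (0 < e)%R.
    rewrite lt_neqAle enorm_ge0 andbT eq_sym; apply: contraNN hp0 => /eqP e0.
    by move: hBe; rewrite e0 expr0n eqn0Ngt d0 invr0 mulr0 normr_le0.
  have [Gp ap Fp] := hsub p hp0.
  have [se|es] := ltP s e.
    rewrite -[leLHS]adde0; apply: leeD => //; rewrite lee_fin.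
    apply: (le_trans hBe); rewrite ler_wpM2l// lef_pV2 ?posrE ?exprn_gt0//.
    by rewrite lerXn2r ?nnegrE ?ltW.
  (* the smallest [k] with [sk k.+1 < e] also satisfies [e <= sk k] *)
  have ex : exists k : nat, (sk k.+1 < e)%R.
    pose k := Num.bound (s / e).
    have hk : (s / e < N%:R ^+ k :> R)%R.
      apply: lt_trans (archi_boundP _) _; first by rewrite divr_ge0// ltW.
      by rewrite -natrX ltr_nat ltn_expl.
    exists k; rewrite /sk ltr_pdivrMr ?exprn_gt0// mulrC -ltr_pdivrMr//.
    apply: lt_le_trans hk _; rewrite exprS ler_peMl ?exprn_ge0 ?ltW// .
    by rewrite ltr1n.
  have := ex_minnP ex; case: ex_minnP => k ke mink _.
  have ek : (e <= sk k)%R.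
    case: k mink {ke} => [|k] mink; first by rewrite /sk expr0 divr1.
    by rewrite leNgt; apply/negP => /mink; rewrite ltnn.
  rewrite -[leLHS]add0e; apply: leeD; first by rewrite lee_fin.
  apply: le_trans (nneseries_lim_ge k.+1 _); last by move=> ? _ _; exact: bD0.
  rewrite big_nat_recr//= -[leLHS]add0e; apply: leeD.
    by apply: sume_ge0 => j _; exact: bD0.
  rewrite indicE mem_set ?mule1; last first.
    by split => //; split => //; exact: le_trans Fp ek.
  rewrite lee_fin; apply: (le_trans hBe); rewrite ler_wpM2l//.
  rewrite lef_pV2 ?posrE ?exprn_gt0//.
  by rewrite lerXn2r ?nnegrE ?ltW.
apply: (@le_lt_trans _ _ (\int[mu \x mu]_p g p)).
  apply: ge0_le_integral => //.
    by apply: measurableT_comp => //; exact/measurable_EFinP.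
  by apply: emeasurable_funD.
rewrite ge0_integralD//.
rewrite integral_nneseries//.
apply: lte_add_pinfty.
  rewrite (integral_cst (mu \x mu))// -ge0_fin_numE//.
    rewrite fin_numM// -setXTT [X in X \is a fin_num]product_measure1E//.
    by rewrite fin_numM// fin_num_measure.
  by rewrite mule_ge0.
pose M : R := (B * `|C| * N%:R ^+ d * A * (1 - theta)^-1)%R.
apply: (@le_lt_trans _ _ M%:E); last exact: ltry.
apply: lime_le.
  by apply: is_cvg_nneseries => k _ _; apply: integral_ge0 => p _; exact: bD0.
apply: nearW => K.
apply: (@le_trans _ _ (\sum_(0 <= k < K)
    (B * `|C| * N%:R ^+ d * A * theta ^+ k)%:E)).
  apply: lee_sum => k _.
  rewrite ge0_integralZl_EFin//; last first.
    by apply/measurable_EFinP; exact: measurable_indic.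
  rewrite integral_indic// setIT.
  apply: (@le_trans _ _ ((b k)%:E *
     (`|C| * (sk k) ^+ d * (A * theta ^+ k))%:E)).
    apply: lee_wpmul2l; first by rewrite lee_fin.
    apply: (le_trans (strip_measure _ _ (sk0 k))); rewrite lee_fin.
    by rewrite ler_wpM2l ?decay// mulr_ge0// exprn_ge0// ltW.
  rewrite -EFinM lee_fin le_eqVlt; apply/orP; left; apply/eqP.
  rewrite /b /sk exprS !expr_div_n exprMn; field.
  by rewrite !expf_neq0 ?gt_eqF ?exprn_gt0.
rewrite sumEFin lee_fin -mulr_sumr /M ler_wpM2l ?sum_geometric_le//.
by rewrite !mulr_ge0// exprn_ge0// ltW.
Qed.

End sheet_integrable.

(** * Antisymmetric kernels and truncated integrals *)

Section product_swap.
Local Open Scope ereal_scope.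
Context d (T : measurableType d) (R : realType).
Variable mu : {sigma_finite_measure set T -> \bar R}.

Lemma product_measure_swap (A : set (T * T)) : measurable A ->
  (mu \x mu) [set p | A (p.2, p.1)] = (mu \x mu) A.
Proof.
move=> mA; rewrite [RHS](@product_measure_unique _ _ _ _ _ _ _ (mu \x^ mu))//.
by move=> B D mB mD; exact: product_measure2E.
Qed.

Lemma integral_swap (f : T * T -> \bar R) :
  (mu \x mu).-integrable setT f ->
  (mu \x mu).-integrable setT (fun p => f (p.2, p.1)) ->
  \int[mu \x mu]_p f (p.2, p.1) = \int[mu \x mu]_p f p.
Proof.
by move=> intf intfs; rewrite -integral12_prod_meas1// -integral21_prod_meas1.
Qed.

Lemma product_null_section (Z : set (T * T)) :
  measurable Z -> (mu \x mu) Z = 0 ->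
  exists X, [/\ measurable X, mu X = 0 & forall x, ~ X x -> mu (xsection Z x) = 0].
Proof.
move=> mZ Z0.
have mf := measurable_fun_xsection mu mZ.
have : \int[mu]_x `|(mu \o xsection Z) x| = 0.
  by rewrite -[RHS]Z0; apply: eq_integral => x _; rewrite gee0_abs.
move=> /(ae_eq_integral_abs mu measurableT mf)[X [mX X0 hX]].
exists X; split => // x Xx; apply: contrapT => h; apply: Xx; apply: hX => /=.
by move=> /(_ I).
Qed.

End product_swap.

Section kernel.
Local Open Scope ereal_scope.
Context (R : realType) (n : nat).
Let T := borelRn R n.
Variables (mu : {finite_measure set T -> \bar R}) (K : 'rV[R]_n -> R).

Let dist (p : T * T) : R := enorm ((p.1 : 'rV[R]_n) - p.2).

Lemma product_measureT_lty : (mu \x mu) setT < +oo.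
Proof.
rewrite -setXTT [ltLHS]product_measure1E//.
by rewrite lte_mul_pinfty// -?ge0_fin_numE ?fin_num_measure.
Qed.

Lemma integrable_bounded (h : T * T -> R) (M : R) : measurable_fun setT h ->
  (forall p, `|h p| <= M)%R -> (mu \x mu).-integrable setT (EFin \o h).
Proof.
move=> mh hM; apply: measurable_bounded_integrable => //.
  exact: product_measureT_lty.
exists M; split; first exact: num_real.
by move=> B MB p _; exact: le_trans (hM p) (ltW MB).
Qed.

Hypothesis hKmeas : mu_measurable_kernel mu K.
Hypothesis hKanti : forall x : 'rV[R]_n, x != 0%R -> K (- x)%R = (- K x)%R.
Variable CK : R.
Hypothesis hKsize : forall x : 'rV[R]_n, x != 0%R ->
  (`|K x| <= CK * enorm x ^- n.-1)%R.

(** Outside a null set the kernel on pairs agrees with a Borel function. The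
    null set is first made symmetric, so that setting the kernel to zero on it
    and on the diagonal preserves antisymmetry as well as the size estimate. *)
Lemma borel_kernel : exists (k : T * T -> R) (Z : set (T * T)),
  [/\ measurable Z, (mu \x mu) Z = 0 & measurable_fun setT k] /\
  [/\ forall p, k (p.2, p.1) = (- k p)%R,
      forall p, (`|k p| <= `|CK| * dist p ^- n.-1)%R &
      forall p, ~ Z p -> p.1 != p.2 -> k p = K ((p.1 : 'rV[R]_n) - p.2)%R].
Proof.
pose D := [set p : T * T | p.1 != p.2].
have DE (p : T * T) : D p <-> (0 < dist p)%R by rewrite /dist enorm_gt0 subr_eq0.
have mD : measurable D.
  rewrite (_ : D = [set p | 0 < dist p]%R); last first.
    by apply/seteqP; split => p /DE.
  by apply: measurable_lt_set => //; exact: measurable_dist.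
pose K2 (p : T * T) : R := K ((p.1 : 'rV[R]_n) - p.2)%R.
have [Z0 [mZ0 Z00 mK]] : exists Z, [/\ measurable Z, (mu \x mu) Z = 0 &
    measurable_fun (D `\` Z) K2].
  apply: caratheodory_fun_ae_measurable => //; first exact: product_measureT_lty.
  by have [_] := hKmeas.
pose Z1 := [set p | Z0 (p.2, p.1)].
have mZ1 : measurable Z1.
  rewrite -[Z1]setTI; exact: (measurable_swap measurableT mZ0).
have mZ : measurable (Z0 `|` Z1) by exact: measurableU.
pose k := K2 \_ (D `\` (Z0 `|` Z1)).
exists k, (Z0 `|` Z1); split; split => //.
- apply: null_set_setU => //; rewrite -[RHS]Z00.
  exact: product_measure_swap.
- apply/(measurable_restrictT K2); first by apply: measurableD.
  apply: measurable_funS mK; first by apply: measurableD.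
  by move=> p [Dp Zp]; split => // Z0p; apply: Zp; left.
- move=> [x y]; rewrite /k !patchE /=.
  have -> : ((y, x) \in D `\` (Z0 `|` Z1)) = ((x, y) \in D `\` (Z0 `|` Z1)).
    apply/idP/idP; rewrite !inE => -[Dp Zp]; split.
    - by move: Dp; rewrite /D/= eq_sym.
    - by move=> h; apply: Zp; case: h => ?; [right|left].
    - by move: Dp; rewrite /D/= eq_sym.
    - by move=> h; apply: Zp; case: h => ?; [right|left].
  case: ifPn => [|_]; last by rewrite oppr0.
  rewrite inE => -[Dp _]; rewrite /K2/= -hKanti ?opprB//.
  by rewrite subr_eq0.
- move=> p; rewrite /k patchE; case: ifPn => [|_].
    rewrite inE => -[/DE Dp _]; apply: le_trans (hKsize _) _.
      by rewrite -enorm_gt0.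
    by rewrite ler_wpM2r ?ler_norm// invr_ge0 exprn_ge0// enorm_ge0.
  by rewrite normr0 mulr_ge0// invr_ge0 exprn_ge0// enorm_ge0.
- by move=> p Zp Dp; rewrite /k patchE mem_set.
Qed.

Section truncated_integral.
Variables (k : T * T -> R) (Z : set (T * T)).
Hypotheses (mZ : measurable Z) (Z0 : (mu \x mu) Z = 0)
  (mk : measurable_fun setT k).
Hypothesis kanti : forall p, k (p.2, p.1) = (- k p)%R.
Hypothesis ksize : forall p, (`|k p| <= `|CK| * dist p ^- n.-1)%R.
Hypothesis kK : forall p, ~ Z p -> p.1 != p.2 ->
  k p = K ((p.1 : 'rV[R]_n) - p.2)%R.

Let far eps : set (T * T) := [set p | eps < dist p]%R.

Lemma measurable_far eps : measurable (far eps).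
Proof. by apply: measurable_lt_set => //; exact: measurable_dist. Qed.

Definition cut_kernel eps (p : T * T) : R := (\1_(far eps) p * k p)%R.

Lemma measurable_cut_kernel eps : measurable_fun setT (cut_kernel eps).
Proof.
by apply: measurable_funM => //; apply: measurable_indic; exact: measurable_far.
Qed.

Lemma cut_kernel_le eps p : (0 < eps)%R ->
  (`|cut_kernel eps p| <= `|CK| * eps ^- n.-1)%R.
Proof.
move=> e0; rewrite /cut_kernel indicE.
have [|_] := boolP (p \in far eps); last first.
  by rewrite mul0r normr0 mulr_ge0// invr_ge0 exprn_ge0// ltW.
rewrite inE mul1r /far/= => ep; apply: (le_trans (ksize p)).
have d0 : (0 < dist p)%R := lt_trans e0 ep.
rewrite ler_wpM2l// lef_pV2 ?posrE ?exprn_gt0//.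
by rewrite lerXn2r ?nnegrE ?ltW.
Qed.

Variables (f g : T -> R) (M : R).
Hypotheses (mf : measurable_fun setT f) (mg : measurable_fun setT g)
  (fM : forall x, (`|f x| <= M)%R) (gM : forall x, (`|g x| <= M)%R).

Let H eps p : R := (cut_kernel eps p * f p.2 * g p.1)%R.

Lemma integrable_truncated_form eps : (0 < eps)%R ->
  (mu \x mu).-integrable setT (EFin \o H eps).
Proof.
move=> e0; apply: (@integrable_bounded _ (`|CK| * eps ^- n.-1 * M * M)%R).
  apply: measurable_funM; last exact: (measurableT_comp mg).
  apply: measurable_funM; first exact: measurable_cut_kernel.
  exact: (measurableT_comp mf).
move=> p; rewrite 2!normrM; apply: ler_pM; rewrite ?mulr_ge0//.
by apply: ler_pM => //; exact: cut_kernel_le.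
Qed.

(** For almost every [x] the section of the exceptional set is null, so that
    the inner integral may be taken with the Borel version of the kernel;
    another null set of values of [x] disappears in the outer integral, and
    Fubini's theorem applies since the truncated kernel is bounded. *)
Lemma integral_truncated eps : (0 < eps)%R ->
  \int[@completed_measure_extension _ _ _ mu]_x
     (truncated mu K eps f x * (g x)%:E) = \int[mu \x mu]_p (H eps p)%:E.
Proof.
move=> e0.
have [X [mX X0 hX]] := product_null_section mZ Z0.
have iH := integrable_truncated_form e0.
rewrite -[RHS]/(\int[mu \x mu]_p (EFin \o H eps) p) -integral12_prod_meas1//.
apply: (integral_completed mX X0); last exact: integrable_fubini_F.
move=> x Xx.
have mcx : measurable_fun setT (fun y : T => cut_kernel eps (x, y) * f y)%R.
  apply: measurable_funM => //.
  by apply: (measurableT_comp (measurable_cut_kernel eps)); exact: measurable_pair1.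
have icx : mu.-integrable setT (fun y : T => (cut_kernel eps (x, y) * f y)%:E).
  apply: (@measurable_bounded_integrable _ _ _ mu
    (fun y : T => cut_kernel eps (x, y) * f y)%R) => //.
    by rewrite -ge0_fin_numE ?fin_num_measure.
  exists (`|CK| * eps ^- n.-1 * M)%R; split; first exact: num_real.
  move=> B MB y _; apply: le_trans (ltW MB).
  by rewrite normrM; apply: ler_pM => //; exact: cut_kernel_le.
have -> : truncated mu K eps f x = \int[mu]_y (cut_kernel eps (x, y) * f y)%:E.
  rewrite /truncated integral_mkcond.
  apply: (integral_completed (measurable_xsection x mZ) (hX x Xx)) => // y Zy.
  rewrite patchE /cut_kernel indicE.
  have -> : ((x, y) \in far eps) = (y \in [set y0 | (eps < enorm (x - y0))%R]).
    by apply/idP/idP; rewrite !inE.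
  case: ifPn => [|_]; last by rewrite mul0r mul0r.
  rewrite inE => /= exy; rewrite mul1r kK//.
    by move=> h; apply: Zy; rewrite /xsection/= inE.
  by rewrite -subr_eq0 -enorm_gt0; exact: lt_trans exy.
rewrite -integralZr//.
Qed.

Let W p : R := (k p * (f p.2 * g p.1 - f p.1 * g p.2) / 2)%R.

(** Average the integral with the one obtained by exchanging the two variables,
    which changes the sign of the kernel. *)
Lemma integral_antisym eps : (0 < eps)%R ->
  \int[mu \x mu]_p (H eps p)%:E =
  \int[mu \x mu]_p (\1_(far eps) p * W p)%:E.
Proof.
move=> e0; have iH := integrable_truncated_form e0.
have HsE p : H eps (p.2, p.1) = (- cut_kernel eps p * f p.1 * g p.2)%R.
  have farC : ((p.2, p.1) \in far eps) = (p \in far eps).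
    by apply/idP/idP; rewrite !inE /far/= /dist/= enormB.
  by rewrite /H /cut_kernel !indicE farC /= kanti mulrN.
have iHs : (mu \x mu).-integrable setT (fun p => (EFin \o H eps) (p.2, p.1)).
  apply: (@eq_integrable _ _ _ _ _ measurableT
    (EFin \o (fun p => - cut_kernel eps p * f p.1 * g p.2)%R)).
    by move=> p _ /=; rewrite HsE.
  apply: (@integrable_bounded _ (`|CK| * eps ^- n.-1 * M * M)%R).
    apply: measurable_funM; last exact: (measurableT_comp mg).
    apply: measurable_funM; last exact: (measurableT_comp mf).
    by apply: measurableT_comp => //; exact: measurable_cut_kernel.
  move=> p; rewrite 2!normrM normrN; apply: ler_pM; rewrite ?mulr_ge0//.
  by apply: ler_pM => //; exact: cut_kernel_le.
have E2 : \int[mu \x mu]_p (H eps p)%:E =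
    2^-1%:E * (\int[mu \x mu]_p (EFin \o H eps) p +
               \int[mu \x mu]_p (EFin \o H eps) (p.2, p.1)).
  rewrite integral_swap// -[\int[_]_p (_ \o _) p]/(\int[mu \x mu]_p (H eps p)%:E).
  have := integrable_fin_num measurableT iH.
  case: (\int[mu \x mu]_p _) => // r _.
  by rewrite -EFinD -EFinM; congr EFin; field.
rewrite E2 -integralD// -integralZl//; last exact: integrableD.
apply: eq_integral => p _ /=; rewrite HsE -EFinD -EFinM; congr EFin.
by rewrite /H /cut_kernel /W; field.
Qed.

Hypothesis iW : (mu \x mu).-integrable setT (EFin \o W).

(** After antisymmetrization the integrand [W] may be integrable although
    [k p * f p.2 * g p.1] is not, and then the truncations converge by
    dominated convergence. On the diagonal, which no truncation reaches, [W]
    vanishes. *)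
Lemma truncated_cvg : exists l : R,
  (fun eps : R => \int[@completed_measure_extension _ _ _ mu]_x
     (truncated mu K eps f x * (g x)%:E)) @ 0%R^'+ --> l%:E.
Proof.
pose J (eps : R) := \int[mu \x mu]_p (\1_(far eps) p * W p)%:E.
have mW : measurable_fun setT W by apply/measurable_EFinP; exact: measurable_int iW.
have mJ eps : measurable_fun setT (fun p => (\1_(far eps) p * W p)%:E).
  apply/measurable_EFinP; apply: measurable_funM => //.
  by apply: measurable_indic; exact: measurable_far.
have JW eps p : `|(\1_(far eps) p * W p)%:E| <= (EFin \o (fun q => `|W q|)%R) p.
  rewrite /= lee_fin normrM indicE; case: (_ \in _) => /=.
    by rewrite normr1 mul1r.
  by rewrite normr0 mul0r.
have iaW : (mu \x mu).-integrable setT (EFin \o (fun q => `|W q|)%R).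
  exact: (integrable_abse iW).
have iJ eps : (mu \x mu).-integrable setT (fun p => (\1_(far eps) p * W p)%:E).
  apply: le_integrable iaW => // p _; apply: (le_trans (JW eps p)).
  by rewrite /= lee_fin normr_id.
have finJ eps : J eps \is a fin_num by exact: integrable_fin_num.
have finW : \int[mu \x mu]_p (W p)%:E \is a fin_num.
  exact: (integrable_fin_num _ iW).
exists (fine (\int[mu \x mu]_p (W p)%:E)).
apply: (@cvg_trans _ (J @ 0%R^'+)).
  apply: near_eq_cvg; near=> eps.
  by rewrite integral_truncated// integral_antisym.
apply/fine_cvgP; split; first by apply: nearW => eps; exact: finJ.
apply/cvg_at_rightP => u [u0 ucvg].
suff : (fun m => J (u m)) @ \oo --> \int[mu \x mu]_p (W p)%:E.
  by rewrite -[X in _ --> X -> _](fineK finW) => /fine_cvgP[].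
have hcvg p : (fun m => (\1_(far (u m)) p * W p)%:E) @ \oo --> (W p)%:E.
  have [p0|p0] := leP (dist p) 0%R.
    have -> : W p = 0%R.
      have /eqP : dist p = 0%R by apply/eqP; rewrite eq_le p0 enorm_ge0.
      rewrite /dist enorm_eq0 subr_eq0 /W => /eqP ->.
      by rewrite subrr mulr0 mul0r.
    by under eq_fun do rewrite mulr0; exact: cvg_cst.
  apply: cvg_near_cst; near=> m.
  rewrite indicE mem_set ?mul1r//=; near: m.
  exact: (cvgr_lt 0%R ucvg).
have mW' : measurable_fun setT (EFin \o W) by exact/measurable_EFinP.
have [_ _] := dominated_convergence measurableT (fun m => mJ (u m)) mW'
  (aeW _ (fun p _ => hcvg p)) iaW (aeW _ (fun p m _ => JW (u m) p)).
exact.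
Unshelve. all: by end_near. Qed.

End truncated_integral.
End kernel.

(** * Reduction to thin sheets *)

Section criterion.
Local Open Scope ereal_scope.
Context (R : realType) (n : nat).
Let T := borelRn R n.
Variables (mu : {finite_measure set T -> \bar R}) (K : 'rV[R]_n -> R).
Hypothesis hKmeas : mu_measurable_kernel mu K.
Hypothesis hKanti : forall x : 'rV[R]_n, x != 0%R -> K (- x)%R = (- K x)%R.
Variable CK : R.
Hypothesis hKsize : forall x : 'rV[R]_n, x != 0%R ->
  (`|K x| <= CK * enorm x ^- n.-1)%R.
Variable S : 'rV[R]_n -> R -> set 'rV[R]_n.
Hypothesis mS : forall x r, measurable (S x r : set T).

Lemma char_span_measurable (f : 'rV[R]_n -> R) :
  char_span S f -> measurable_fun setT (f : T -> R).
Proof.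
move=> [m [a [x [r [_ ->]]]]]; apply: measurable_sum => j.
by apply: measurable_funM => //; exact: measurable_indic.
Qed.

Lemma char_span_bounded (f : 'rV[R]_n -> R) :
  char_span S f -> exists M, forall x, (`|f x| <= M)%R.
Proof.
move=> [m [a [x [r [_ ->]]]]]; exists (\sum_(j < m) `|a j|)%R => z.
apply: (le_trans (ler_norm_sum _ _ _)); apply: ler_sum => j _.
rewrite normrM ler_piMr// indicE; case: (_ \in _) => /=.
  by rewrite normr1.
by rewrite normr0.
Qed.

Hypothesis hS : forall k : T * T -> R, measurable_fun setT k ->
  (forall p, `|k p| <= `|CK| * enorm ((p.1 : 'rV[R]_n) - p.2) ^- n.-1)%R ->
  forall x r, (0 < r)%R -> (mu \x mu).-integrable setT
    (fun p => (k p * (\1_(S x r) p.1 - \1_(S x r) p.2))%:E).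

(** The antisymmetrized form of [f] and [g] is the combination
    [g x * (f y - f x) + f x * (g x - g y)] of differences of one function, and
    by linearity it is enough to treat differences of characteristic functions. *)
Lemma weak_convergence_criterion : converges_weakly mu K (char_span S).
Proof.
move=> f g hf hg.
have [k [Z [[mZ Z0 mk] [kanti ksize kK]]]] := borel_kernel hKmeas hKanti hKsize.
have ik (phi : 'rV[R]_n -> R) : char_span S phi ->
    (mu \x mu).-integrable setT (EFin \o (fun p => k p * (phi p.1 - phi p.2))%R).
  move=> [m [a [x [r [r0 ->]]]]].
  apply: (eq_integrable measurableT (fun p => \sum_(j < m) ((a j)%:E *
      (k p * (\1_(S (x j) (r j)) p.1 - \1_(S (x j) (r j)) p.2))%:E))).
    move=> p _ /=; rewrite -sumrB mulr_sumr -sumEFin.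
    by apply: eq_bigr => j _; rewrite -EFinM; congr EFin; ring.
  apply: (integrable_sum measurableT) => j _.
  by apply: integrableZl => //; exact: hS.
have [Mf hMf] := char_span_bounded hf; have [Mg hMg] := char_span_bounded hg.
have mf := char_span_measurable hf; have mg := char_span_measurable hg.
apply: (truncated_cvg mZ Z0 mk kanti ksize kK mf mg
  (M := (Num.max Mf Mg)%R)).
- by move=> x; rewrite le_max hMf.
- by move=> x; rewrite le_max hMg orbT.
have bdd (phi : T -> R) (M : R) : (forall x, `|phi x| <= M)%R ->
    [bounded (phi p.1 / 2)%R | p in [set: T * T]].
  move=> hM; exists M; split; first exact: num_real.
  move=> B MB p _ /=; apply: le_trans (ltW MB); rewrite normrM.
  apply: le_trans (hM p.1); rewrite ler_piMr//.
  by rewrite ger0_norm// invf_le1// ler1n.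
apply: (eq_integrable measurableT
   ((EFin \o (fun p => k p * (g p.1 - g p.2))%R) \*
      (EFin \o (fun p => f p.1 / 2)%R) \+
   (fun p => (-1)%:E * ((EFin \o (fun p => k p * (f p.1 - f p.2))%R) \*
      (EFin \o (fun p => g p.1 / 2)%R)) p))).
  by move=> p _ /=; rewrite -!EFinM -EFinD; congr EFin; field.
apply: integrableD => //.
  apply: integrableMl => //; [exact: ik|  |exact: bdd hMf].
  by apply: measurable_funM => //; exact: (measurableT_comp mf).
apply: integrableZl => //.
apply: integrableMl => //; [exact: ik|  |exact: bdd hMg].
by apply: measurable_funM => //; exact: (measurableT_comp mg).
Qed.

End criterion.

Section thin_sheets.
Local Open Scope ereal_scope.
Context (R : realType) (d : nat).
Let T := borelRn R d.+1.
Variables (mu : {finite_measure set T -> \bar R}).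

(** Geometric decay at an unspecified scale and rate is all that the
    integrability argument uses, so pieces with different porosity constants
    can be treated together. *)
Definition thin_sheet (i : 'I_d.+1) (G : set 'rV[R]_d.+1)
    (F : 'rV[R]_d.+1 -> R) (a : 'I_d -> R) (l : R) : Prop :=
  exists N A s theta,
  [/\ (1 < N)%N, (0 <= A)%R, (0 < s)%R & (0 <= theta < 1)%R] /\
  forall k, (mass mu (patch i G F a l (s / N%:R ^+ k)) <= A * theta ^+ k)%R.

Hypothesis rmu : radon mu.
Variables (C : R).
Hypothesis hgrowth : forall (x : 'rV[R]_d.+1) (r : R), spt mu x -> (0 < r)%R ->
  mu (eball x r) <= (C * r ^+ d)%:E.
Hypothesis d0 : (0 < d)%N.

(** Near the diagonal the support of [h] is distributed over finitely many
    sheets; each of them may come with its own scales and rate of decay, which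
    is why the sum over scales is carried out sheet by sheet. *)
Lemma thin_sheets_integrable (J : finType) (i : J -> 'I_d.+1)
    (G : J -> set 'rV[R]_d.+1) (F : J -> 'rV[R]_d.+1 -> R)
    (a : J -> 'I_d -> R) (l : J -> R) (rho B : R) (h : T * T -> R) :
  (forall t, measurable (G t : set T)) ->
  (forall t, measurable_fun setT (F t : T -> R)) ->
  (forall t, thin_sheet (i t) (G t) (F t) (a t) (l t)) ->
  (0 < rho)%R -> (0 <= B)%R -> measurable_fun setT h ->
  (forall p, `|h p| <= B * enorm ((p.1 : 'rV[R]_d.+1) - p.2) ^- d)%R ->
  (forall p, h p != 0%R -> (enorm ((p.1 : 'rV[R]_d.+1) - p.2) <= rho)%R ->
    exists t, patch (i t) (G t) (F t) (a t) (l t)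
      (enorm ((p.1 : 'rV[R]_d.+1) - p.2)) p.1) ->
  (mu \x mu).-integrable setT (EFin \o h).
Proof.
move=> mG mF thin rho0 B0 mh hB hsub.
pose dist (p : T * T) := enorm ((p.1 : 'rV[R]_d.+1) - p.2).
pose U t := [set p : T * T | patch (i t) (G t) (F t) (a t) (l t) (dist p) p.1].
have UE t p : U t p <-> [/\ G t p.1, forall j, (a t j <=
    (p.1 : 'rV[R]_d.+1) ord0 (lift (i t) j) <= a t j + l t)%R &
    (`|F t p.1| <= dist p)%R] by [].
have mU t : measurable (U t).
  rewrite (_ : U t = [set p : T * T | `|F t p.1| <= dist p]%R `&`
    ((G t `&` [set x : T | forall j,
        a t j <= x ord0 (lift (i t) j) <= a t j + l t]%R) `*` setT)); last first.
    by apply/seteqP; split => p; [move=> []|move=> [? [[]]]].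
  apply: measurableI.
    apply: measurable_le_set; last exact: measurable_dist.
    apply: measurableT_comp => //.
    exact: (measurableT_comp (mF t) measurable_fst).
  by apply: measurableX => //; apply: measurableI => //; exact: measurable_box.
pose ht t p : R := (\1_(U t) p * h p)%R.
have mht t : measurable_fun setT (ht t).
  by apply: measurable_funM => //; exact: measurable_indic.
have iht t : (mu \x mu).-integrable setT (EFin \o ht t).
  have [N [A [s [theta [[N1 A0 s0 th] decay]]]]] := thin t.
  apply: (sheet_integrable rmu hgrowth d0 (mG t) (mF t) N1 A0 s0 th decay (mht t) B0).
    move=> p; apply: le_trans (hB p); rewrite normrM ler_piMl// indicE.
    by case: (_ \in _); rewrite /= ?normr1 ?normr0.
  move=> p; rewrite /ht indicE; case: (boolP (p \in U t)) => [|_].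
    by rewrite inE => /UE.
  by rewrite mul0r eqxx.
pose far := [set p : T * T | rho < dist p]%R.
have mfar : measurable far by apply: measurable_lt_set => //; exact: measurable_dist.
have ifar : (mu \x mu).-integrable setT (EFin \o (fun p => \1_far p * h p)%R).
  apply: (@integrable_bounded _ _ _ _ (B * rho ^- d)%R).
    by apply: measurable_funM => //; exact: measurable_indic.
  move=> p; rewrite indicE; have [|_] := boolP (p \in far); last first.
    by rewrite mul0r normr0 mulr_ge0// invr_ge0 exprn_ge0// ltW.
  rewrite inE mul1r => fp; apply: (le_trans (hB p)); rewrite ler_wpM2l//.
  have dp : (0 < dist p)%R := lt_trans rho0 fp.
  by rewrite lef_pV2 ?posrE ?exprn_gt0// lerXn2r ?nnegrE ?ltW.
have isum : (mu \x mu).-integrable setT (fun p =>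
    `|(\1_far p * h p)%:E| + \sum_(t : J) `|(ht t p)%:E|).
  apply: integrableD => //; first exact: (integrable_abse ifar).
  by apply: integrable_sum => // t _; exact: (integrable_abse (iht t)).
apply: le_integrable isum => //; first exact/measurable_EFinP.
move=> p _; rewrite [leRHS]gee0_abs; last first.
  by rewrite adde_ge0// sume_ge0.
have [hp0|hp] := eqVneq (h p) 0%R.
  by rewrite /= hp0 normr0 adde_ge0// sume_ge0.
have [pd|pd] := ltP rho (dist p).
  rewrite [\1_far p]indicE mem_set// mul1r -[leLHS]adde0 leeD//.
  by rewrite sume_ge0.
have [t Ut] := hsub p hp pd.
rewrite -[leLHS]add0e; apply: leeD => //.
rewrite (bigD1 t)//= -[leLHS]adde0; apply: leeD; last exact: sume_ge0.
by rewrite /ht indicE mem_set// mul1r.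
Qed.

End thin_sheets.

(** * Directed porosity *)

(** Directed porosity with one constant that serves all points of [E]. *)
Definition has_holes (R : realType) n (E V : set 'rV[R]_n) (c : R) : Prop :=
  forall x r, E x -> 0 < r ->
  exists y, V (y - x) /\ eball y (c * r) `<=` eball x r `\` E.

Section holes.
Context (R : realType) (n : nat).
Implicit Types (E V : set 'rV[R]_n).

Lemma directed_porous_holes E V :
  directed_porous E V -> exists2 c, 0 < c & has_holes E V c.
Proof.
move=> [_ pc0].
have [c c0 cpc] : exists2 c : R, 0 < c & (c%:E < porosity_constant E V)%E.
  move: pc0; case: (porosity_constant E V) => [r||] //.
    by rewrite lte_fin => r0; exists (r / 2); rewrite ?lte_fin; lra.
  by move=> _; exists 1; rewrite ?ltr01 ?ltry.
exists c => // x r Ex r0.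
have : (c%:E < ereal_sup [set e%:E | e in admissible E V x])%E.
  by apply: lt_le_trans cpc _; apply: ereal_inf_lbound; exists x.
move=> /ereal_sup_gt[_ [e [e0 /(_ r r0)[y [Vy yE]]] <-]]; rewrite lte_fin => ce.
exists y; split => // z yz; apply: yE; apply: le_trans yz _.
by rewrite ler_pM2r// ltW.
Qed.

Lemma eball_center (x : 'rV[R]_n) r : 0 <= r -> eball x r x.
Proof.
move=> r0; rewrite /eball/= subrr.
by have /eqP -> : enorm (0 : 'rV[R]_n) == 0 by rewrite enorm_eq0.
Qed.

Lemma has_holes_center E V c x r : 0 < c -> has_holes E V c -> E x -> 0 < r ->
  exists y, [/\ V (y - x), eball y (c * r) `<=` eball x r `\` E &
                enorm (y - x) <= r].
Proof.
move=> c0 hole Ex r0; have [y [Vy yE]] := hole x r Ex r0.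
exists y; split => //.
by have [] := yE y (eball_center y (ltW (mulr_gt0 c0 r0))).
Qed.

End holes.

Section thin.
Context (R : realType) (d : nat).
Let T := borelRn R d.+1.
Variables (mu : {finite_measure set T -> \bar R}).
Hypothesis rmu : radon mu.
Variables (C : R).
Hypothesis hgrowth : forall (x : 'rV[R]_d.+1) (r : R), spt mu x -> 0 < r ->
  (mu (eball x r) <= (C * r ^+ d)%:E)%E.

Lemma thin_sheet_of_holes (i : 'I_d.+1) (G G' : set 'rV[R]_d.+1)
    (F : 'rV[R]_d.+1 -> R) (L c r0 : R) a l :
  0 < L -> G `<=` G' ->
  (forall x z e, G' x -> G z -> 0 <= e ->
    (forall j, `|x ord0 (lift i j) - z ord0 (lift i j)| <= e) ->
    enorm (x - z) <= L * (e + `|F x - F z|)) ->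
  0 < c -> 0 < r0 ->
  (forall x r, spt mu x -> G x -> 0 < r -> r <= r0 ->
    exists y, [/\ G' y, eball y (c * r) `<=` eball x r `\` spt mu &
                  `|F y - F x| <= c * r / (4 * L)]) ->
  0 < l -> thin_sheet mu i G F a l.
Proof.
move=> L0 GG' FL c0 r00 hole l0.
have m_null A : A `&` spt mu = set0 -> mass mu A = 0 by exact: mass_null.
have m_ball x r : spt mu x -> 0 < r -> mass mu (eball x r) <= C * r ^+ d.
  by move=> sx r_gt0; rewrite -lee_fin massE ?hgrowth//; exact: measurable_eball.
exact: (patch_decay L0 GG' FL c0 r00 hole (@mass_le _ _ mu)
  (mass_bigcup mu) m_null m_ball).
Qed.

(** For a coordinate hyperplane the defect is a coordinate, which porosity in
    the direction of the hyperplane leaves unchanged. *)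
Lemma hyperplane_thin (i : 'I_d.+1) (h : R) a l :
  directed_porous (spt mu) (coord_hyperplane (R := R) i) -> 0 < l ->
  thin_sheet mu i setT (fun x => x ord0 i - h) a l.
Proof.
move=> /directed_porous_holes[c c0 hole] l0.
apply: (@thin_sheet_of_holes _ _ setT _ d.+1%:R c 1) => //.
  move=> x z e _ _ e0 xz.
  apply: (le_trans (ler_enorm_sum _)); rewrite (bigD1_ord i)//= !mxE.
  have -> : x ord0 i - h - (z ord0 i - h) = x ord0 i - z ord0 i by ring.
  have : \sum_(j < d) `|(x - z) ord0 (lift i j)| <= d%:R * e.
    rewrite -[d in d%:R]card_ord -sum1_card natr_sum mulr_suml.
    by apply: ler_sum => j _; rewrite mul1r !mxE.
  have := normr_ge0 (x ord0 i - z ord0 i); have d0 : 0 <= d%:R :> R by [].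
  by rewrite -[d.+1%:R]natr1; nra.
move=> x r Ex _ r0 _.
have [y [yV yE]] := hole x r Ex r0.
exists y; split => //.
rewrite (_ : _ - _ = (y - x) ord0 i); last by rewrite !mxE; ring.
by rewrite yV normr0 divr_ge0 ?mulr_ge0 ?ltW.
Qed.

End thin.

Section normals.
Context (R : realType) (n : nat).
Implicit Types (u v x y : 'rV[R]_n).

Lemma normal_hyperplane v : v != 0 ->
  exists V : {vspace 'rV[R]_n}, \dim V = n.-1 /\
    [set x | x \in V] = [set x | dotv x v = 0].
Proof.
move=> v0; pose f : 'Hom('rV[R]_n, 'rV[R]_1) := linfun (mulmxr v^T).
have fE x : f x = (dotv x v)%:M.
  rewrite lfunE/=; apply/matrixP => a b; rewrite !mxE !ord1 eqxx mulr1n.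
  by apply: eq_bigr => j _; rewrite mxE.
exists (lker f); split; last first.
  apply/seteqP; split => x /=.
    by rewrite memv_ker fE => /eqP/matrixP/(_ 0 0); rewrite !mxE eqxx mulr1n.
  by move=> xv; rewrite memv_ker fE xv; apply/eqP/matrixP => a b; rewrite !mxE mul0rn.
have dim_rV : dim 'rV[R]_n = n by exact: mul1n.
have := limg_ker_dim f fullv; rewrite capfv dimvf dim_rV => dimE.
suff im1 : \dim (f @: fullv) = 1%N.
  by move: dimE; rewrite im1 addn1 => /(congr1 predn).
apply/eqP; rewrite eqn_leq; apply/andP; split.
  by have := dimvS (subvf (f @: fullv)); rewrite dimvf.
rewrite lt0n dimv_eq0; apply: contraNneq v0 => im0.
have : f v \in (f @: fullv)%VS by apply: memv_img; exact: memvf.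
rewrite im0 memv0 fE => /eqP/matrixP/(_ 0 0); rewrite !mxE eqxx mulr1n => vv.
by rewrite -enorm_eq0 enormE vv sqrtr0.
Qed.

Lemma near_scaled_dist (x : 'rV[R]_n) (e : R) : 0 < e ->
  \forall y \near x, n%:R * `|x - y| < e.
Proof.
move=> e0; have n0 : 0 < n.+1%:R :> R by [].
apply/nbhs_ballP; exists (e / n.+1%:R); first exact: divr_gt0.
move=> y; rewrite -ball_normE/= ltr_pdivlMr// mulrC.
by apply: le_lt_trans; rewrite ler_wpM2r// ler_nat.
Qed.

Lemma enorm_continuous : continuous (@enorm R n).
Proof.
move=> x; apply/(@cvgrPdist_lt _ _ _ (nbhs x)) => e e0.
near=> y.
apply: le_lt_trans (ler_dist_enorm x y) _.
apply: le_lt_trans (ler_enorm_norm _) _; near: y; exact: near_scaled_dist.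
Unshelve. all: by end_near. Qed.

Lemma compact_unit_sphere : compact [set v : 'rV[R]_n | enorm v = 1].
Proof.
apply: bounded_closed_compact.
  exists 1; split; first exact: num_real.
  by move=> M M1 v /= v1; rewrite (le_trans (ler_norm_enorm v))// v1 ltW.
apply: (@closed_comp _ _ (@enorm R n) [set 1]); last exact: closed_eq.
by move=> v _; exact: enorm_continuous.
Qed.

(** A hole whose centre is on the hyperplane normal to [v] gives one, of half
    the relative size, for all nearby unit normals [u]: move its centre by the
    orthogonal projection to the hyperplane normal to [u]. Compactness of the
    unit sphere then yields a constant common to all directions. *)
Lemma uniform_holes (E : set 'rV[R]_n) :
  (forall V : {vspace 'rV[R]_n}, \dim V = n.-1 ->
     directed_porous E [set v | v \in V]) ->
  exists2 c, 0 < c &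
    forall v, enorm v = 1 -> has_holes E [set x | dotv x v = 0] c.
Proof.
move=> hV.
pose P (c : R) v := enorm v = 1 -> has_holes E [set x | dotv x v = 0] c.
have cover v : enorm v = 1 -> \forall u \near v & c \near 0^'+, P c u.
  move=> v1; have v0 : v != 0 by rewrite -enorm_gt0 v1.
  have [V [dimV VE]] := normal_hyperplane v0.
  have := directed_porous_holes (hV V dimV); rewrite VE => -[c0 c0_gt0 hole].
  exists ([set u | n%:R * `|v - u| < c0 / 2], [set c : R | c < c0 / 2]).
    by split; [apply: near_scaled_dist|apply: nbhs_right_lt]; rewrite divr_gt0.
  move=> [u c] /= [vu /ltW cc0] u1 x r Ex r0.
  have [y [yv yE yx]] := has_holes_center c0_gt0 hole Ex r0.
  have uv : enorm (u - v) <= c0 / 2.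
    by rewrite enormB (le_trans (ler_enorm_norm _))// ltW.
  pose s := dotv (y - x) u.
  have sr : `|s| <= r * (c0 / 2).
    have -> : s = dotv (y - x) (u - v) by rewrite dotvDr dotvNr yv subr0.
    apply: (le_trans (cauchy_schwarz _ _)).
    by apply: ler_pM => //; exact: enorm_ge0.
  exists (y - s *: u); split.
    rewrite /= addrAC dotvDl dotvNl dotvZl -/s -sqr_enorm u1 expr1n mulr1.
    by rewrite subrr.
  move=> z yz; apply: yE; rewrite /eball/= in yz *.
  apply: (le_trans (ler_enorm_trans z (y - s *: u) y)).
  rewrite addrAC subrr sub0r enormN enormZ u1 mulr1.
  have : c * r <= c0 / 2 * r by rewrite ler_pM2r.
  by move: yz sr; lra.
have := compact_unit_sphere => /compact_near_coveringP.
move=> /(_ _ (0 : R)^'+ P _ cover) nearP.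
near (0 : R)^'+ => c; exists c; first by near: c; exact: nbhs_right_gt.
by move=> v v1; apply: (near nearP c) => //.
Unshelve. all: by end_near. Qed.

End normals.

(** * Faces of cubes and spheres *)

Section sphere.
Context (R : realType) (d : nat).
Let T := borelRn R d.+1.
Variables (c : 'rV[R]_d.+1) (r : R) (i : 'I_d.+1) (b : bool).
Hypothesis r0 : 0 < r.

(** A polynomial substitute for the distance to the sphere. If [y - z] is
    tangential at [z], that is, orthogonal to [z - c], then by Pythagoras the
    defect changes only by a multiple of the square of the length of [y - z].
    The factor [3 * r] makes the defect at most the distance to the sphere near
    the sphere. *)
Definition sphere_defect (z : 'rV[R]_d.+1) : R :=
  (dotv (z - c) (z - c) - r ^+ 2) / (3 * r).

(** For [e > 0] the half-spaces for the two values of [b] isolate the places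
    where the sphere is a Lipschitz graph over the coordinates other than the
    [i]-th one; the bound on the norm keeps the constants uniform. *)
Definition cap (e k : R) : set 'rV[R]_d.+1 :=
  [set z | e <= (-1) ^+ b * (z - c) ord0 i /\ enorm (z - c) <= k * r].

(** Where the [i]-th coordinate is bounded away from zero, the difference of
    its squares controls the difference of its values, and the equation of the
    sphere expresses that square by the defect and by the other coordinates. *)
Lemma sphere_lipschitz x z e : cap 0 3 x -> cap (r / (2 * d.+1%:R)) 2 z ->
  0 <= e -> (forall j, `|x ord0 (lift i j) - z ord0 (lift i j)| <= e) ->
  enorm (x - z) <= 11 * d.+1%:R ^+ 2 *
    (e + `|sphere_defect x - sphere_defect z|).
Proof.
move=> [xi xr] [zi zr] e0 xz.
pose u := x - c; pose v := z - c.
have uvE k : x ord0 k - z ord0 k = u ord0 k - v ord0 k by rewrite !mxE; ring.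
set D := `|_ - _|.
have n1 : 1 <= d.+1%:R :> R by rewrite ler1n.
have dE : d%:R = d.+1%:R - 1 :> R by rewrite -natr1 addrK.
have coord (w : 'rV[R]_d.+1) (k : R) j :
    enorm w <= k * r -> `|w ord0 j : R| <= k * r.
  by apply: le_trans; exact: ler_coord_enorm.
have sq : `|dotv u u - dotv v v| = 3 * r * D.
  rewrite /D /sphere_defect -mulrBl normrM opprB addrA subrK.
  rewrite [`|(3 * r)^-1|]ger0_norm ?invr_ge0 ?mulr_ge0 ?ltW//.
  by rewrite mulrCA divff ?mulr1// mulf_neq0// gt_eqF.
have dotE (w : 'rV[R]_d.+1) :
    dotv w w = w ord0 i ^+ 2 + \sum_(j < d) w ord0 (lift i j) ^+ 2.
  by rewrite /dotv (bigD1_ord i)//= -expr2; congr (_ + _).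
have sumE : `|\sum_(j < d) u ord0 (lift i j) ^+ 2 -
              \sum_(j < d) v ord0 (lift i j) ^+ 2| <= d%:R * (e * (5 * r)).
  rewrite -sumrB; apply: (le_trans (ler_norm_sum _ _ _)).
  rewrite -[d in d%:R]card_ord -sum1_card natr_sum mulr_suml.
  apply: ler_sum => j _; rewrite mul1r subr_sqr normrM.
  apply: ler_pM => //; first by rewrite -uvE.
  apply: (le_trans (ler_normD _ _)).
  have := coord u 3 (lift i j) xr; have := coord v 2 (lift i j) zr; lra.
(* the equation of the sphere controls the remaining coordinate *)
have ui : `|u ord0 i - v ord0 i| * (r / (2 * d.+1%:R)) <=
    3 * r * D + d%:R * (e * (5 * r)).
  apply: (@le_trans _ _ `|u ord0 i ^+ 2 - v ord0 i ^+ 2|).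
    rewrite subr_sqr normrM; apply: ler_wpM2l => //.
    rewrite -/u -/v in xi zi; move: xi zi; rewrite ler_normr.
    case: (b) => /=; rewrite ?expr1 ?expr0 ?mulN1r ?mul1r => xi zi; apply/orP.
      by right; rewrite opprD; apply: le_trans zi _; rewrite lerDr.
    by left; apply: le_trans zi _; rewrite lerDr.
  rewrite (_ : u ord0 i ^+ 2 - v ord0 i ^+ 2 = (dotv u u - dotv v v) -
     (\sum_(j < d) u ord0 (lift i j) ^+ 2 -
      \sum_(j < d) v ord0 (lift i j) ^+ 2)); last by rewrite !dotE; ring.
  by apply: (le_trans (ler_normB _ _)); rewrite sq lerD2l.
have {}ui : `|u ord0 i - v ord0 i| <= 2 * d.+1%:R * (3 * D + d%:R * (5 * e)).
  move: ui; rewrite [leLHS]mulrA ler_pdivrMr ?mulr_gt0 ?(lt_le_trans ltr01 n1)//.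
  rewrite (_ : (_ + _) * _ = 2 * d.+1%:R * (3 * D + d%:R * (5 * e)) * r).
    by rewrite ler_pM2r.
  by ring.
apply: (le_trans (ler_enorm_sum _)); rewrite (bigD1_ord i)//= !mxE uvE.
have : \sum_(j < d) `|(x - z) ord0 (lift i j)| <= d%:R * e.
  rewrite -[d in d%:R]card_ord -sum1_card natr_sum mulr_suml.
  by apply: ler_sum => j _; rewrite mul1r !mxE.
have D0 : 0 <= D by exact: normr_ge0.
move: ui; rewrite dE; move: (d.+1%:R) n1 => N n1.
set A := `|_ - _|; set S := \sum_(_ < _) _ => hA hS.
have NN : N <= N ^+ 2 by rewrite expr2 ler_peMl// (le_trans ler01).
have h1 : N * D <= N ^+ 2 * D by rewrite ler_wpM2r.
have h2 : N * e <= N ^+ 2 * e by rewrite ler_wpM2r.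
have h3 : e <= N * e by rewrite ler_peMl.
have h4 : D <= N * D by rewrite ler_peMl.
have -> : 11 * N ^+ 2 * (e + D) = 11 * (N ^+ 2 * e) + 11 * (N ^+ 2 * D) by ring.
have hA' : A <= 6 * (N * D) + 10 * (N ^+ 2 * e) - 10 * (N * e).
  by apply: (le_trans hA); rewrite le_eqVlt; apply/orP; left; apply/eqP; ring.
have hS' : S <= N * e - e by apply: (le_trans hS); rewrite mulrBl mul1r.
lra.
Qed.

End sphere.

Section convergence.
Context (R : realType) (d : nat).
Let T := borelRn R d.+1.
Variables (mu : {finite_measure set T -> \bar R}).
Hypothesis rmu : radon mu.
Variables (C : R).
Hypothesis hgrowth : forall (x : 'rV[R]_d.+1) (r : R), spt mu x -> 0 < r ->
  (mu (eball x r) <= (C * r ^+ d)%:E)%E.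

(** At scales [t] small compared with the porosity constant the tangent plane
    deviates from the sphere by [t ^+ 2 / (3 * r)], much less than the size of
    the holes, so porosity in the direction of the tangent plane is porosity
    along the sphere. *)
Lemma sphere_thin (c : 'rV[R]_d.+1) (r : R) (i : 'I_d.+1) (b : bool) a l :
  (forall V : {vspace 'rV[R]_d.+1}, \dim V = d ->
     directed_porous (spt mu) [set v | v \in V]) ->
  0 < r -> 0 < l ->
  thin_sheet mu i (cap c r i b (r / (2 * d.+1%:R)) 2) (sphere_defect c r) a l.
Proof.
move=> /uniform_holes[k k0 hole] r0 l0.
have n1 : 1 <= d.+1%:R :> R by rewrite ler1n.
have n0 : 0 < 2 * d.+1%:R :> R by rewrite mulr_gt0.
pose L : R := 11 * d.+1%:R ^+ 2.
have L0 : 0 < L by rewrite mulr_gt0// exprn_gt0.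
pose s : R := Num.min (r / (2 * d.+1%:R)) (3 * r * k / (4 * L)).
have s0 : 0 < s by rewrite lt_min !divr_gt0 ?mulr_gt0.
apply: (@thin_sheet_of_holes _ _ _ rmu C hgrowth _ _ (cap c r i b 0 3) _ L k s) => //.
- move=> z [zi zr]; split; last by apply: (le_trans zr); rewrite ler_pM2r// ler_nat.
  by apply: le_trans zi; rewrite divr_ge0 ?ltW.
- by move=> x z e; exact: sphere_lipschitz.
move=> x t Ex [xi xr] t0; rewrite le_min => /andP[tr tk].
have x_neq0 : x - c != 0.
  rewrite -enorm_gt0; apply: lt_le_trans (le_trans _ (ler_coord_enorm (x - c) i)).
    by apply: (@divr_gt0 _ r (2 * d.+1%:R)).
  apply: (le_trans xi); apply: (le_trans (ler_norm _)).
  by rewrite normrM normrX normrN1 expr1n mul1r.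
have e0 : 0 < enorm (x - c) by rewrite enorm_gt0.
pose v := (enorm (x - c))^-1 *: (x - c).
have v1 : enorm v = 1.
  by rewrite enormZ ger0_norm ?invr_ge0 ?enorm_ge0// mulVf// gt_eqF.
have [y [yv yE yx]] := has_holes_center k0 (hole v v1) Ex t0.
have {}yv : dotv (y - x) (x - c) = 0.
  move: yv; rewrite /v /= dotvZr => /eqP; rewrite mulf_eq0 invr_eq0.
  by rewrite gt_eqF//= => /eqP.
have yc : y - c = (y - x) + (x - c) by rewrite addrA subrK.
exists y; split => //.
- split; last first.
    rewrite yc; apply: (le_trans (ler_enormD _ _)).
    have rr : r / (2 * d.+1%:R) <= r.
      by rewrite ler_pdivrMr// ler_peMr ?(ltW r0)//; lra.
    by have := le_trans tr rr; move: yx xr; clear; lra.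
  rewrite yc mxE mulrDr.
  have : `|(-1) ^+ b * (y - x) ord0 i| <= t.
    by rewrite normrM normrX normrN1 expr1n mul1r (le_trans (ler_coord_enorm _ _)).
  rewrite ler_norml => /andP[+ _]; move: tr xi; clear.
  by move: (r / _) => q; lra.
have -> : sphere_defect c r y - sphere_defect c r x =
    enorm (y - x) ^+ 2 / (3 * r).
  by rewrite /sphere_defect yc (pythagoras yv) sqr_enorm; ring.
rewrite ger0_norm; last by rewrite divr_ge0 ?exprn_ge0 ?enorm_ge0 ?mulr_ge0 ?ltW.
apply: (@le_trans _ _ (t ^+ 2 / (3 * r))).
  by rewrite ler_pM2r ?invr_gt0 ?mulr_gt0// lerXn2r ?nnegrE ?enorm_ge0// ltW.
rewrite ler_pdivrMr ?mulr_gt0// expr2.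
apply: (@le_trans _ _ (t * (3 * r * k / (4 * L)))); first by rewrite ler_pM2l.
by rewrite le_eqVlt; apply/orP; left; apply/eqP; ring.
Qed.

Hypothesis d0 : (0 < d)%N.

(** A pair separated by the boundary of the cube is close to one of the
    [2 * (d + 1)] hyperplanes that contain its faces. *)
Lemma cube_integrable (k : T * T -> R) (B : R) (c : 'rV[R]_d.+1) (r : R) :
  (forall i, directed_porous (spt mu) (coord_hyperplane (R := R) i)) ->
  measurable_fun setT k -> 0 <= B ->
  (forall p, `|k p| <= B * enorm ((p.1 : 'rV[R]_d.+1) - p.2) ^- d) -> 0 < r ->
  (mu \x mu)%E.-integrable setT
    (fun p => (k p * (\1_(cube c r) p.1 - \1_(cube c r) p.2))%:E).
Proof.
move=> por mk B0 hk r0.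
pose face (t : 'I_d.+1 * bool) : R := c ord0 t.1 + (-1) ^+ t.2 * (r / 2).
apply: (@thin_sheets_integrable _ _ _ rmu C hgrowth d0
  ('I_d.+1 * bool)%type fst (fun=> setT) (fun t x => x ord0 t.1 - face t)
  (fun t j => c ord0 (lift t.1 j) - (r / 2 + 1)) (fun=> r + 2) 1 B).
- by move=> t; exact: measurableT.
- by move=> t; apply: measurable_funB => //; exact: measurable_coord.
- by move=> t; apply: (hyperplane_thin rmu hgrowth) => //; rewrite addr_gt0.
- by [].
- by [].
- apply: measurable_funM => //; apply: measurable_funB.
    by apply: (measurableT_comp _ measurable_fst); apply: measurable_indic;
      exact: measurable_cube.
  by apply: (measurableT_comp _ measurable_snd); apply: measurable_indic;
    exact: measurable_cube.
- move=> p; apply: le_trans (hk p); rewrite normrM ler_piMr// !indicE.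
  by do 2 case: (_ \in _); rewrite ?subrr ?subr0 ?sub0r ?normrN ?normr0 ?normr1.
move=> [p q] /=; set e := enorm _ => hpq e1.
have pq j : `|p ord0 j - q ord0 j| <= e.
  by have := ler_coord_enorm (p - q) j; rewrite !mxE.
(* one of the two points lies in the cube and the other one is cut off from
   it by a face, which is thus at distance at most [e] from both *)
suff [x [y [xc yc xy]]] : exists x y, [/\ cube c r x, ~ cube c r y &
    x = p /\ y = q \/ x = q /\ y = p].
  have {}xyE j : `|x ord0 j - y ord0 j| <= e /\
      (p ord0 j = x ord0 j \/ p ord0 j = y ord0 j).
    case: xy => -[-> ->]; split;
      [exact: pq|by left|by rewrite distrC; exact: pq|by right].
  have {}pq : forall j, c ord0 j - (r / 2 + 1) <= p ord0 j <=
      c ord0 j - (r / 2 + 1) + (r + 2).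
    move=> j; have [+ hp] := xyE j; have := xc j.
    by rewrite ler_norml; case: hp => ->; lra.
  have [i yi] : exists i, ~~ (c ord0 i - r / 2 <= y ord0 i < c ord0 i + r / 2).
    by apply/not_existsP => h; apply: yc => i; apply: contrapT => /negP; exact: h.
  have [+ hp] := xyE i; have := xc i; rewrite ler_norml => xi xyi.
  move: yi; rewrite negb_and -!ltNge -leNgt => /orP[yi|yi].
    exists (i, true); split => //; rewrite /face/= expr1 mulN1r ler_norml.
    by case: hp => ->; lra.
  exists (i, false); split => //; rewrite /face/= expr0 mul1r ler_norml.
  by case: hp => ->; lra.
move: hpq; rewrite !indicE.
have [pc|pc] := boolP (p \in cube c r); have [qc|qc] := boolP (q \in cube c r).
- by rewrite subrr mulr0 eqxx.
- by rewrite inE in pc; rewrite notin_setE in qc; exists p, q; split => //; left.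
- by rewrite notin_setE in pc; rewrite inE in qc; exists q, p; split => //; right.
- by rewrite subrr mulr0 eqxx.
Qed.

Lemma measurable_sphere_defect (c : 'rV[R]_d.+1) r :
  measurable_fun setT (sphere_defect c r : T -> R).
Proof.
apply: measurable_funM => //; apply: measurable_funB => //.
apply: measurable_sum => i; under eq_fun do rewrite !mxE.
by apply: measurable_funM; apply: measurable_funB => //; exact: measurable_coord.
Qed.

Lemma measurable_cap (c : 'rV[R]_d.+1) r i b e k :
  measurable (cap c r i b e k : set T).
Proof.
rewrite (_ : cap c r i b e k =
  [set z : T | e <= (-1) ^+ b * (z - c :> 'rV[R]_d.+1) ord0 i] `&`
  eball c (k * r)); last by [].
apply: measurableI; last exact: measurable_eball.
apply: measurable_le_set => //; under eq_fun do rewrite !mxE.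
apply: measurable_funM => //; apply: measurable_funB => //.
exact: measurable_coord.
Qed.

(** A pair separated by the sphere has both points within their mutual distance
    from it; at least one coordinate of [p - c] is not small, so the pair is
    seen by one of the [2 * (d + 1)] caps on which the sphere is a graph. *)
Lemma ball_integrable (k : T * T -> R) (B : R) (c : 'rV[R]_d.+1) (r : R) :
  (forall V : {vspace 'rV[R]_d.+1}, \dim V = d ->
     directed_porous (spt mu) [set v | v \in V]) ->
  measurable_fun setT k -> 0 <= B ->
  (forall p, `|k p| <= B * enorm ((p.1 : 'rV[R]_d.+1) - p.2) ^- d) -> 0 < r ->
  (mu \x mu)%E.-integrable setT
    (fun p => (k p * (\1_(eball c r) p.1 - \1_(eball c r) p.2))%:E).
Proof.
move=> por mk B0 hk r0.
have n1 : 1 <= d.+1%:R :> R by rewrite ler1n.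
apply: (@thin_sheets_integrable _ _ _ rmu C hgrowth d0
  ('I_d.+1 * bool)%type fst (fun t => cap c r t.1 t.2 (r / (2 * d.+1%:R)) 2)
  (fun=> sphere_defect c r)
  (fun t j => c ord0 (lift t.1 j) - 2 * r) (fun=> 4 * r) (r / 2) B).
- by move=> t; exact: measurable_cap.
- by move=> t; exact: measurable_sphere_defect.
- by move=> t; apply: sphere_thin => //; rewrite mulr_gt0.
- by rewrite divr_gt0.
- by [].
- apply: measurable_funM => //; apply: measurable_funB.
    by apply: (measurableT_comp _ measurable_fst); apply: measurable_indic;
      exact: measurable_eball.
  by apply: (measurableT_comp _ measurable_snd); apply: measurable_indic;
    exact: measurable_eball.
- move=> p; apply: le_trans (hk p); rewrite normrM ler_piMr// !indicE.
  by do 2 case: (_ \in _); rewrite ?subrr ?subr0 ?sub0r ?normrN ?normr0 ?normr1.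
move=> [p q] /=; set e := enorm (p - q) => hpq er.
have pq : `|enorm (p - c) - enorm (q - c)| <= e.
  apply: (le_trans (ler_dist_enorm _ _)).
  by rewrite (_ : p - c - (q - c) = p - q)// opprB addrA subrK.
have pr : `|enorm (p - c) - r| <= e.
  move: hpq pq; rewrite !indicE ler_norml => hpq pq; rewrite ler_norml.
  have [pc|pc] := boolP (p \in eball c r); have [qc|qc] := boolP (q \in eball c r).
  - by move: hpq; rewrite pc qc subrr mulr0 eqxx.
  - rewrite inE /eball/= in pc; rewrite notin_setE /eball/= in qc.
    by move/negP: qc; rewrite -ltNge; lra.
  - rewrite notin_setE /eball/= in pc; rewrite inE /eball/= in qc.
    by move/negP: pc; rewrite -ltNge; lra.
  - by move: hpq; rewrite (negbTE pc) (negbTE qc) subrr mulr0 eqxx.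
have [pl pu] : r / 2 <= enorm (p - c) /\ enorm (p - c) <= 2 * r.
  by move: pr; rewrite ler_norml; lra.
have coord j : `|p ord0 j - c ord0 j| <= enorm (p - c).
  by have := ler_coord_enorm (p - c) j; rewrite !mxE.
(* a coordinate of [p - c] of at least average size *)
have [i hi] : exists i, r / (2 * d.+1%:R) <= `|(p - c) ord0 i|.
  apply/not_existsP => h.
  have : enorm (p - c) < \sum_(i < d.+1) r / (2 * d.+1%:R).
    apply: le_lt_trans (ler_enorm_sum _) _; rewrite big_ord_recl [ltRHS]big_ord_recl.
    have lt_i i : `|(p - c) ord0 i| < r / (2 * d.+1%:R).
      by rewrite ltNge; apply/negP; exact: h.
    by apply: ltr_leD => //; apply: ler_sum => i _; exact: ltW.
  rewrite sumr_const card_ord -[_ *+ _]mulr_natr.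
  have -> : r / (2 * d.+1%:R) * d.+1%:R = r / 2.
    by field; rewrite gt_eqF// (lt_le_trans ltr01 n1).
  by rewrite ltNge pl.
exists (i, (p - c) ord0 i < 0); split.
- split => //=; have [h|h] := ltP ((p - c) ord0 i) 0.
    by rewrite expr1 mulN1r -ltr0_norm.
  by rewrite expr0 mul1r -[leRHS]ger0_norm.
- move=> j /=; have := le_trans (coord (lift i j)) pu.
  by rewrite ler_norml; lra.
rewrite /sphere_defect -sqr_enorm subr_sqr -mulrA normrM.
apply: (@le_trans _ _ (e * 1)); last by rewrite mulr1.
apply: ler_pM => //.
rewrite ger0_norm; last by rewrite divr_ge0 ?addr_ge0 ?enorm_ge0 ?mulr_ge0 ?ltW.
by rewrite ler_pdivrMr ?mulr_gt0//; lra.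
Qed.

End convergence.

Theorem theorem1p4 (R : realType) (n : nat) (hn : (2 <= n)%N)
  (mu : {finite_measure set (borelRn R n) -> \bar R}) (hmu : radon mu)
  (C : R)
  (hgrowth : forall (x : 'rV[R]_n) (r : R), spt mu x -> 0 < r ->
     (mu (eball x r) <= (C * r ^+ n.-1)%:E)%E)
  (K : 'rV[R]_n -> R)
  (hKmeas : mu_measurable_kernel mu K)
  (hKanti : forall x : 'rV[R]_n, x != 0 -> K (- x) = - K x)
  (CK : R)
  (hKsize : forall x : 'rV[R]_n, x != 0 -> `|K x| <= CK * enorm x ^- n.-1) :
  ((forall i : 'I_n, directed_porous (spt mu) (coord_hyperplane (R:=R) i)) ->
     converges_weakly mu K (@XQ R n)) /\
  ((forall V : {vspace 'rV[R]_n}, \dim V = n.-1 ->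
      directed_porous (spt mu) [set v | v \in V]) ->
     converges_weakly mu K (@XB R n)).
Proof.
case: n hn mu hmu hgrowth K hKmeas hKanti hKsize => // d d0 mu rmu hgrowth K.
move=> hKmeas hKanti hKsize; split => por.
  apply: (weak_convergence_criterion hKmeas hKanti hKsize).
    exact: measurable_cube.
  by move=> k mk hk x r r0; exact: (cube_integrable rmu hgrowth d0 x por mk (normr_ge0 CK) hk r0).
apply: (weak_convergence_criterion hKmeas hKanti hKsize).
  exact: measurable_eball.
by move=> k mk hk x r r0; exact: (ball_integrable rmu hgrowth d0 x por mk (normr_ge0 CK) hk r0).
Qed.
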